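(* Let $P(s,r,p)$ be a polynomial of degree $t$ in the complex variable $s$, with complex (in particular, possibly real) coefficients depending polynomially on two real parameters $r,p$ (or, equivalently, on one complex parameter $r+jp$), and let $d$ be its maximal total degree as a polynomial in $r$ and $p$. Suppose that $\Re(P(j\omega,r,p))$ and $\Im(P(j\omega,r,p))$, as polynomials, have no common divisor depending non-trivially on $\omega$. Then the number of regions of the $D$-decomposition of the $(r,p)$-plane for $P$ is at most $\frac{q^2+q+2}{2}$, where $q=2td+2d$.
   Context: Here $j=\sqrt{-1}$ and $\omega$ is a real variable. Write $P(s,r,p)=\sum_{i=0}^{t}a_i(r,p)s^i$, with $a_t$ the coefficient of $s^t$. The border of the $D$-decomposition (continuous-time case) is the set $B\subseteq\mathbb{R}^2$ of parameters $(r,p)$ such that either there is a real $\omega$ with $P(j\omega,r,p)=0$ (a root on the imaginary axis), or $a_t(r,p)=0$. The regions of the $D$-decomposition (root-invariant regions) are the connected components of $\mathbb{R}^2\setminus B$. *)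

(* Defs.v *)
From HB Require Import structures.
From mathcomp Require Import all_boot all_order all_algebra.
From mathcomp Require Import complex.
From mathcomp Require Import all_classical all_reals all_analysis.
Set Implicit Arguments. Unset Strict Implicit. Unset Printing Implicit Defensive.
Import Order.TTheory GRing.Theory Num.Theory.
Import numFieldNormedType.Exports.
Local Open Scope ring_scope.
Local Open Scope classical_set_scope.
Local Open Scope complex_scope.

Section DDecomp.
Variable R : realType.
Local Notation C := (R[i]).

(* A polynomial in the two real parameters (r,p) with complex coefficients is
   represented as f : {poly {poly C}}, f = sum_k f_k(r) p^k
   (outer variable p, inner variable r). *)
Definition bieval (f : {poly {poly C}}) (r p : R) : C :=
  (f.[(p%:C)%:P]).[r%:C].

(* total degree in (r,p) of a nonzero bivariate polynomial (0 for f = 0) *)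
Definition totdeg (f : {poly {poly C}}) : nat :=
  \max_(k < size f | (nth 0%R f k != 0)%R) (k + (size (nth 0%R f k)).-1)%N.

Definition Peval (t : nat) (a : nat -> {poly {poly C}}) (s : C) (r p : R) : C :=
  \sum_(i < t.+1) bieval (a i) r p * s ^+ i.

Definition Pdeg_rp (t : nat) (a : nat -> {poly {poly C}}) : nat :=
  \max_(i < t.+1) totdeg (a i).

(* Re P(j w, r, p) and Im P(j w, r, p) as real polynomials in (w, r, p),
   represented in {poly {poly {poly R}}}: outer variable w, then p, then r. *)
Definition ReP_jw (t : nat) (a : nat -> {poly {poly C}}) : {poly {poly {poly R}}} :=
  \poly_(i < t.+1) map_poly (map_poly (fun c : C => @complex.Re R ('i ^+ i * c))) (a i).
Definition ImP_jw (t : nat) (a : nat -> {poly {poly C}}) : {poly {poly {poly R}}} :=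
  \poly_(i < t.+1) map_poly (map_poly (fun c : C => @complex.Im R ('i ^+ i * c))) (a i).

Definition rdivides (g f : {poly {poly {poly R}}}) : Prop := exists h, f = g * h.

Definition depends_on_w (g : {poly {poly {poly R}}}) : Prop := (1 < size g)%N.

Definition Dborder (t : nat) (a : nat -> {poly {poly C}}) : set (R * R) :=
  [set rp | (exists w : R, Peval t a ('i * w%:C) rp.1 rp.2 = 0)
            \/ bieval (a t) rp.1 rp.2 = 0].

Definition Dregion (t : nat) (a : nat -> {poly {poly C}}) (x : R * R) : set (R * R) :=
  @connected_component (R * R)%type (~` Dborder t a) x.

End DDecomp.

(* Main.v *)
(* The border lies in the zero set of F = Res_w(Re P(jw), Im P(jw)) * |a_t|^2,
   a polynomial in (r, p) of total degree at most q.  The resultant is nonzero by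
   Gauss's lemma over the factorial ring R[r, p], and the complement of the border
   is open, so it suffices to bound the number N of connected components of
   [F != 0] by (q^2 + q + 2) / 2.

   Shear the plane so that F has a term y^q and sweep it by vertical lines.  A
   component unbounded to the left meets a far left line, which the zeros of F cut
   into at most q + 1 pieces; likewise on the right.  A component bounded to the
   left has, near its left end, vertical gaps between consecutive zeros of F which
   shrink to a point, so for every small h it has a gap of length exactly h near
   its left end, and similarly another one near its right end.  The lower endpoint
   of such a gap is a common zero of F(x, y) and of F(x, y + h) - F(x, y), which
   have degrees q and q - 1 and no common component for small h, so that there are
   at most q (q - 1) gaps by Bezout.
   Adding up left and right ends, 2 N <= q (q - 1) + 2 (q + 1). *)

Require Import Defs.
From HB Require Import structures.
From mathcomp Require Import all_boot all_order all_algebra.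
From mathcomp Require Import perm zify ring lra complex polyorder polyrcf.
From mathcomp Require Import all_classical all_reals all_analysis.
Set Implicit Arguments. Unset Strict Implicit. Unset Printing Implicit Defensive.
Import Order.TTheory GRing.Theory Num.Theory.
Import numFieldNormedType.Exports.
Local Open Scope ring_scope.

(** * Factorial domains and Gauss's lemma *)

(** Counting the ends of regions by critical points of the projection to x fails: F may have
    multiple factors, and several regions may have their leftmost point at the same singular point
    of the curve. Gaps of a fixed length h > 0 cure both. The midpoint of a gap lies in its region,
    so different regions have different gaps, and the left and right gaps of one region lie on
    either side of a chosen point of it; a single Bezout bound covers them all. That F(x, y) and
    F(x, y + h) have no common component is visible in the column x = 0 alone: a common root there
    is a pair of complex roots of F(0, y) with difference h, and such differences are finite in
    number. The price is a limit argument for the existence of a gap, in which a zero without sign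
    change could appear inside the limit segment; hence a squarefree polynomial with the same zeros
    as F in almost all columns. Origin of q: the Sylvester matrix of the two parts of P(jw) has at
    most 2t rows with entries of degree at most d, and |a_t|^2 adds 2d. *)

Definition divides (S : idomainType) (a b : S) : Prop := exists c, b = a * c.

Definition prime_elt (S : idomainType) (p : S) : Prop :=
  [/\ p != 0, p \isn't a GRing.unit &
      forall a b, divides p (a * b) -> divides p a \/ divides p b].

Definition factorial_domain (S : idomainType) : Prop :=
  forall c : S, c != 0 -> exists u (s : seq S),
    [/\ u \is a GRing.unit, forall p, p \in s -> prime_elt p &
        c = u * \prod_(p <- s) p].

Definition primitive_poly (S : idomainType) (f : {poly S}) : Prop :=
  forall p : S, prime_elt p -> ~ divides p%:P f.

Section Divides.
Variable S : idomainType.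
Implicit Types a b c p q : S.

Lemma divides_mulr a b c : divides a b -> divides a (b * c).
Proof. by move=> [d ->]; exists (d * c); rewrite mulrA. Qed.

Lemma divides_mull a b c : divides a b -> divides a (c * b).
Proof. by rewrite mulrC; exact: divides_mulr. Qed.

Lemma dividesD a b c : divides a b -> divides a c -> divides a (b + c).
Proof. by move=> [d ->] [e ->]; exists (d + e); rewrite mulrDr. Qed.

Lemma dividesN a b : divides a b -> divides a (- b).
Proof. by move=> [d ->]; exists (- d); rewrite mulrN. Qed.

Lemma prime_divides_prod p (s : seq S) : prime_elt p ->
  divides p (\prod_(q <- s) q) -> exists2 q, q \in s & divides p q.
Proof.
move=> [p0 pu pP]; elim: s => [|q s IH].
  by rewrite big_nil => -[c /esym] /(congr1 (fun x => x \is a GRing.unit));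
     rewrite unitr1 unitrM (negbTE pu).
rewrite big_cons => /pP [|/IH [r rs pr]]; first by exists q; rewrite ?mem_head.
by exists r; rewrite // inE rs orbT.
Qed.

Lemma prime_divides_prime p q : prime_elt p -> prime_elt q -> divides p q ->
  divides q p.
Proof.
move=> [p0 pu pP] [q0 qu qP] [v qE].
have [] // : divides q p \/ divides q v by apply: qP; exists 1; rewrite mulr1 qE.
move=> [w vE]; have /(mulfI q0) : q * 1 = q * (p * w).
  by rewrite mulr1 mulrCA -vE -qE.
by move=> /esym /(congr1 (fun x => x \is a GRing.unit)); rewrite unitr1 unitrM (negbTE pu).
Qed.

Lemma prime_divides_unitM p u a : prime_elt p -> u \is a GRing.unit ->
  divides p (u * a) -> divides p a.
Proof.
by move=> pp uu [c E]; exists (u^-1 * c); rewrite mulrCA -E mulKr.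
Qed.

Lemma no_prime_divisor_unit c : factorial_domain S -> c != 0 ->
  (forall p, prime_elt p -> ~ divides p c) -> c \is a GRing.unit.
Proof.
move=> ufd c0 nop; have [u [[|p s] [uu sP cE]]] := ufd c c0.
  by rewrite cE big_nil mulr1.
case: (nop p); first by apply: sP; rewrite mem_head.
by exists (u * \prod_(q <- s) q); rewrite cE big_cons mulrCA.
Qed.

Lemma divides_cancel_primes (s : seq S) a g h :
  (forall p, p \in s -> prime_elt p /\ ~ divides p g) ->
  (\prod_(p <- s) p) * a = g * h -> exists h', a = g * h'.
Proof.
elim: s h => [|p s IH] h sP.
  by rewrite big_nil mul1r => ->; exists h.
have [[p0 pu pP] png] := sP p (mem_head _ _).
rewrite big_cons -mulrA => E.
have [] // : divides p g \/ divides p h.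
  by apply: pP; exists (\prod_(q <- s) q * a).
move=> [h1 hE]; apply: (IH h1) => [q qs|]; first by apply: sP; rewrite inE qs orbT.
by apply: (mulfI p0); rewrite E hE mulrCA.
Qed.

End Divides.

Section PolyFactorial.
Variable S : idomainType.

(* Peel off leading terms: p divides the product of the leading coefficients. *)
Lemma prime_polyC (p : S) : prime_elt p -> prime_elt p%:P.
Proof.
move=> pp; have [p0 pu pP] := pp; split; first by rewrite polyC_eq0.
  by rewrite poly_unitE coefC eqxx (negbTE pu) andbF.
move=> f g; have [n] := ubnP (size f + size g); elim: n f g => // n IH f g.
have tail (k : {poly S}) : k != 0 ->
    (size (k - (lead_coef k)%:P * 'X^((size k).-1))%R < size k)%N.
  move=> k0; rewrite -[X in (_ < X)%N]prednK ?size_poly_gt0 // ltnS.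
  apply/leq_sizeP => j; rewrite leq_eqVlt => /predU1P [<-|kj].
    by rewrite coefB coefCM coefXn eqxx mulr1 lead_coefE subrr.
  rewrite coefB coefCM coefXn gtn_eqF // mulr0 subr0 nth_default //.
  by rewrite -[size k]prednK ?size_poly_gt0.
have half (h k : {poly S}) : (size h + size k < n.+1)%N -> h != 0 ->
    divides p (lead_coef h) -> divides p%:P (h * k) ->
    divides p%:P h \/ divides p%:P k.
  move=> hk h0 [c cE] phk; set t := (lead_coef h)%:P * 'X^((size h).-1).
  have pt : divides p%:P t by exists (c%:P * 'X^((size h).-1)); rewrite mulrA -polyCM -cE.
  have [] : divides p%:P (h - t) \/ divides p%:P k.
  - apply: IH; last by rewrite mulrBl; apply: dividesD => //; apply/dividesN/divides_mulr.
    by rewrite -ltnS; apply: leq_trans hk; rewrite ltnS -addSn leq_add2r; apply: tail.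
  - by move=> pht; left; rewrite -[h](subrK t); apply: dividesD.
  - by right.
move=> sz pfg.
have [->|f0] := eqVneq f 0; first by left; exists 0; rewrite mulr0.
have [->|g0] := eqVneq g 0; first by right; exists 0; rewrite mulr0.
have [] : divides p (lead_coef f) \/ divides p (lead_coef g).
- by apply: pP; rewrite -lead_coefM; case: pfg => c ->; exists (lead_coef c);
     rewrite lead_coefM lead_coefC.
- by move=> pf; apply: half.
- by move=> pg; apply/or_comm; apply: half; rewrite 1?addnC 1?mulrC.
Qed.

(** Gauss's lemma in the form used below. Pseudo-division over [S] yields divisibility only up to a
    constant [c]; the primes of [c] stay prime in [{poly S}] and cannot divide the primitive [g], so
    they cancel. *)
Lemma primitive_cancel (c : S) (a g h : {poly S}) : factorial_domain S -> c != 0 ->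
  primitive_poly g -> c *: a = g * h -> divides g a.
Proof.
move=> ufd c0 gP E; have [u [s [uu sP cE]]] := ufd c c0.
have uE : u * u^-1 = 1 by rewrite mulrV.
apply: (@divides_cancel_primes _ [seq p%:P | p <- s] _ _ (u^-1 *: h)).
  move=> _ /mapP [p ps ->]; have pp := sP p ps.
  by split; [exact: prime_polyC | exact: gP].
rewrite big_map -scalerAr -E scalerA cE mulrA mulVr // mul1r -mul_polyC.
by rewrite rmorph_prod.
Qed.

Lemma primitive_part (f : {poly S}) : factorial_domain S -> f != 0 ->
  exists (c : S) f0, [/\ c != 0, f = c *: f0 & primitive_poly f0].
Proof.
(* [s] lists the primes still to be tried on [g], [t] those known not to divide it; together they
   factor the leading coefficient. When [s] is empty, a prime dividing [g] divides the leading
   coefficient, so it is associate to one in [t], which is excluded. *)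
move=> ufd; have gen (s t : seq S) (u : S) (g : {poly S}) : g != 0 ->
    u \is a GRing.unit -> (forall p, p \in s -> prime_elt p) ->
    (forall p, p \in t -> prime_elt p /\ ~ divides p%:P g) ->
    lead_coef g = u * ((\prod_(p <- s) p) * \prod_(p <- t) p) ->
    exists (c : S) f0, [/\ c != 0, g = c *: f0 & primitive_poly f0].
  elim: s t g => [|q s IH] t g g0 uu sP tP gE.
    exists 1, g; split; rewrite ?oner_eq0 ?scale1r // => p pp [k kE].
    have : divides p (u * \prod_(r <- t) r).
      by exists (lead_coef k); move: gE; rewrite big_nil mul1r => <-;
         rewrite kE lead_coefM lead_coefC.
    move=> /(prime_divides_unitM pp uu) /(prime_divides_prod pp) [r rt pr].
    have [rr nrg] := tP r rt; have [v pE] := prime_divides_prime pp rr pr.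
    by apply: nrg; exists (v%:P * k); rewrite mulrA -polyCM -pE.
  have qq := sP q (mem_head _ _); have [q0 _ _] := qq.
  have sP' p : p \in s -> prime_elt p by move=> ps; apply: sP; rewrite inE ps orbT.
  have [[k kE]|nqg] := EM (divides q%:P g).
    have k0 : k != 0 by apply: contra_neq g0 => k0; rewrite kE k0 mulr0.
    have [|p pt||c [f0 [c0 E fP]]] // := IH t k k0 uu.
    - by have [pp npg] := tP p pt; split=> // pk; apply: npg; rewrite kE; apply: divides_mull.
    - apply: (mulfI q0); rewrite -[q in LHS]lead_coefC -lead_coefM -kE gE big_cons.
      by rewrite -!mulrA mulrCA.
    exists (q * c), f0; split=> //; first by rewrite mulf_neq0.
    by rewrite kE E mul_polyC scalerA.
  apply: (IH (q :: t)) => //; last by rewrite gE !big_cons; congr (u * _); rewrite -mulrA mulrCA.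
  by move=> p; rewrite inE => /predU1P [->|/tP].
move=> f0; have l0 : lead_coef f != 0 by rewrite lead_coef_eq0.
have [u [s [uu sP E]]] := ufd _ l0.
by apply: (gen s [::] u) => //; rewrite big_nil mulr1.
Qed.

(** When [f] divides [a * b], irreducibility leaves two cases for the primitive part of [gcdp f a].
    If it is constant, Bezout gives a constant multiple of [b] divisible by [f]; if its cofactor in
    [f] is constant, that constant is a unit and [f] divides [a]. *)
Lemma primitive_prime (f : {poly S}) : factorial_domain S -> (1 < size f)%N ->
  primitive_poly f ->
  (forall g h, f = g * h -> (size g <= 1)%N \/ (size h <= 1)%N) -> prime_elt f.
Proof.
move=> ufd sf fP irr; have f0 : f != 0 by rewrite -size_poly_gt0 (ltn_trans _ sf).
split=> // [|a b [k abE]]; first by rewrite poly_unitE eqn_leq leqNgt sf.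
have g0 : gcdp f a != 0 by rewrite gcdp_eq0 (negbTE f0).
have [d [g [d0 gE gP]]] := primitive_part ufd g0.
have dvd x : (gcdp f a %| x)%R -> divides g x.
  move=> /Pdiv.Idomain.dvdpP [[c q] /= c0 E]; apply: (primitive_cancel ufd c0 gP (h := d *: q)).
  by rewrite E gE -!scalerAr mulrC.
have [h fE] := dvd _ (dvdp_gcdl f a).
have [sg|sh] := irr _ _ fE.
  right; have [[u v] /= uvE] := Pdiv.Idomain.Bezoutp f a.
  have sgcd : size (gcdp f a) = 1%N.
    apply/eqP; rewrite eqn_leq size_poly_gt0 g0 andbT.
    by rewrite gE size_scale.
  have : size (u * f + v * a) = 1%N by rewrite (eqp_size uvE).
  move=> /eqP/size_poly1P [c c0 cE].
  apply: (primitive_cancel ufd c0 fP (h := u * b + v * k)).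
  rewrite -mul_polyC -cE mulrDl -[v * a * b]mulrA abE mulrDr mulrA [f * u]mulrC.
  by rewrite [f * (v * k)]mulrCA.
left; have h0 : h != 0 by apply: contra_neq f0; rewrite fE => ->; rewrite mulr0.
have /eqP/size_poly1P [e e0 hE] : size h = 1%N.
  by apply/eqP; rewrite eqn_leq sh size_poly_gt0.
have eu : e \is a GRing.unit.
  apply: no_prime_divisor_unit => // p pp [x xE]; apply: (fP p pp).
  by exists (g * x%:P); rewrite fE hE xE polyCM mulrCA.
have [l aE] := dvd _ (dvdp_gcdr f a).
exists (e^-1 *: l); rewrite aE fE hE -scalerAr -mulrA mul_polyC scalerAr scalerA.
by rewrite mulVr // scale1r.
Qed.

Lemma factorial_poly : factorial_domain S -> factorial_domain {poly S}.
Proof.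
move=> ufd f; have [n] := ubnP (size f); elim: n f => // n IH f; rewrite ltnS => sn f0.
have const (c : S) : c != 0 -> exists u (s : seq {poly S}),
    [/\ u \is a GRing.unit, forall p, p \in s -> prime_elt p &
        c%:P = u * \prod_(p <- s) p].
  move=> c0; have [u [s [uu sP E]]] := ufd c c0.
  exists u%:P, [seq p%:P | p <- s]; split.
  - have u0 : u != 0 by apply: contraTneq uu => ->; rewrite unitr0.
    by rewrite poly_unitE size_polyC coefC eqxx uu u0.
  - by move=> _ /mapP [p ps ->]; apply/prime_polyC/sP.
  - by rewrite big_map E polyCM rmorph_prod.
have mulF (g h : {poly S}) :
    (exists u (s : seq {poly S}), [/\ u \is a GRing.unit, forall p, p \in s -> prime_elt p &
        g = u * \prod_(p <- s) p]) ->
    (exists u (s : seq {poly S}), [/\ u \is a GRing.unit, forall p, p \in s -> prime_elt p &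
        h = u * \prod_(p <- s) p]) ->
    exists u (s : seq {poly S}), [/\ u \is a GRing.unit, forall p, p \in s -> prime_elt p &
        g * h = u * \prod_(p <- s) p].
  move=> [u [s [uu sP ->]]] [v [t [vu tP ->]]]; exists (u * v), (s ++ t); split.
  - by rewrite unitrM uu.
  - by move=> p; rewrite mem_cat => /orP [/sP|/tP].
  - by rewrite big_cat /= mulrACA.
have [c [g [c0 fE gP]]] := primitive_part ufd f0.
have sfg : size f = size g by rewrite fE size_scale.
rewrite fE -mul_polyC; apply: (mulF); first exact: const.
have [sg|sg] := leqP (size g) 1.
  have /eqP : size g = 1%N by apply/eqP; rewrite eqn_leq sg -sfg size_poly_gt0.
  by move=> /size_poly1P [d d0 ->]; apply: const.
have [[a [b [gE sa sb]]]|irr] :=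
    EM (exists a b, [/\ g = a * b, (1 < size a)%N & (1 < size b)%N]).
  have a0 : a != 0 by rewrite -size_poly_gt0 (ltn_trans _ sa).
  have b0 : b != 0 by rewrite -size_poly_gt0 (ltn_trans _ sb).
  have sE : (size g).+1 = (size a + size b)%N.
    by rewrite gE size_mul // prednK // addn_gt0 (ltn_trans _ sa).
  rewrite gE; apply: (mulF); apply: IH => //; apply: leq_trans sn; rewrite sfg.
    by rewrite -ltnS sE -[X in (X < _)%N]addn1 ltn_add2l.
  by rewrite -ltnS sE -[X in (X < _)%N]add1n ltn_add2r.
exists 1, [:: g]; split; rewrite ?unitr1 ?big_seq1 ?mul1r // => p.
rewrite inE => /eqP ->; apply: primitive_prime => // a b gE.
have [?|sa] := leqP (size a) 1; first by left.
have [?|sb] := leqP (size b) 1; first by right.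
by case: irr; exists a, b.
Qed.

(** [gcdp] is a gcd over the fraction field only; its primitive part divides both polynomials over
    [S] itself. This turns a zero resultant into a common divisor of the kind that the theorem
    forbids. *)
Lemma gauss_common_divisor (a b : {poly S}) : factorial_domain S ->
  (1 < size (gcdp a b))%N ->
  exists g : {poly S}, [/\ (1 < size g)%N, divides g a & divides g b].
Proof.
move=> ufd sg; have g0 : gcdp a b != 0 by rewrite -size_poly_gt0 (ltn_trans _ sg).
have [d [g [d0 gE gP]]] := primitive_part ufd g0.
have dvd x : (gcdp a b %| x)%R -> divides g x.
  move=> /Pdiv.Idomain.dvdpP [[c q] /= c0 E]; apply: (primitive_cancel ufd c0 gP (h := d *: q)).
  by rewrite E gE -!scalerAr mulrC.
by exists g; split; [rewrite gE size_scale in sg | apply/dvd/dvdp_gcdl | apply/dvd/dvdp_gcdr].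
Qed.

End PolyFactorial.

Lemma factorial_field (K : fieldType) : factorial_domain K.
Proof. by move=> c c0; exists c, [::]; rewrite unitfE big_nil mulr1. Qed.

(** * Sylvester matrices *)

Section SylvesterEval.
Variables (S T : comNzRingType) (phi : {rmorphism S -> T}).

(** The rows of the Sylvester matrix are the coefficients of [p * 'X^k] and [q * 'X^k], so the
    powers of a common root form a null vector. *)
Lemma Sylvester_eval (p q : {poly S}) (w : T) i :
  (map_poly phi p).[w] = 0 -> (map_poly phi q).[w] = 0 ->
  \sum_j phi (Sylvester_mx p q i j) * w ^+ j = 0.
Proof.
move=> p0 q0; have band (r : {poly S}) (k : nat) : (map_poly phi r).[w] = 0 ->
    (size r + k <= (size q).-1 + (size p).-1)%N \/ r = 0 ->
    \sum_(j < (size q).-1 + (size p).-1) phi (r`_(j - k) *+ (k <= j)%N) * w ^+ j = 0.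
  move=> r0 sr; have rX : (map_poly phi (r * 'X^k)).[w] = 0.
    by rewrite rmorphM /= hornerM_comm ?r0 ?mul0r //; exact: mulrC.
  rewrite -[RHS]rX (@horner_coef_wide _ ((size q).-1 + (size p).-1)).
    by apply: eq_bigr => j _; rewrite coef_map coefMXn ltnNge; case: leqP.
  rewrite (leq_trans (size_poly _ _)) //.
  case: sr => [sr|->]; last by rewrite mul0r size_poly0.
  have [->|r1] := eqVneq r 0; first by rewrite mul0r size_poly0.
  by rewrite size_mulXn // addnC.
under eq_bigr do rewrite Sylvester_mxE.
case: splitP => k _; apply: band => //; [have := ltn_ord k|have := ltn_ord k].
  have [->|] := eqVneq p 0; first by right.
  by rewrite -size_poly_gt0 => sp kq; left; rewrite -ltnS -(addnS _ (size p).-1) prednK // addnC ltn_add2r.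
have [->|] := eqVneq q 0; first by right.
by rewrite -size_poly_gt0 => sq kp; left; rewrite -ltnS -(addSn (size q).-1) prednK // ltn_add2l.
Qed.

(** Applying the adjugate to the null vector shows that the determinant times this vector is 0, and
    its entry of index 0 is [w ^+ 0 = 1]; the size hypothesis provides that entry. *)
Lemma resultant_common_root (p q : {poly S}) (w : T) :
  (0 < (size q).-1 + (size p).-1)%N ->
  (map_poly phi p).[w] = 0 -> (map_poly phi q).[w] = 0 -> phi (resultant p q) = 0.
Proof.
move=> s0 p0 q0; rewrite -det_map_mx; set M := map_mx _ _.
pose v : 'cV[T]_((size q).-1 + (size p).-1) := \col_j w ^+ j.
have Mv : M *m v = 0.
  apply/matrixP => i j; rewrite !mxE -[RHS](Sylvester_eval i p0 q0).
  by apply: eq_bigr => l _; rewrite !mxE.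
have : \adj M *m (M *m v) = 0 by rewrite Mv mulmx0.
rewrite mulmxA mul_adj_mx mul_scalar_mx => /matrixP /(_ (Ordinal s0) 0).
by rewrite !mxE expr0 mulr1.
Qed.

End SylvesterEval.

(** A permutation uses every column index once, so each term of the determinant has degree at most
    the sum of [alpha] minus the sum of all column indices. This weighting yields the product of the
    degrees in Bezout's bound. *)
Lemma size_det_weighted (S : idomainType) N (M : 'M[{poly S}]_N) (alpha : 'I_N -> nat) D :
  (forall i j, size (M i j) <= (alpha i).+1 - j)%N ->
  (\sum_i alpha i <= D + \sum_(j < N) j)%N -> (size (\det M) <= D.+1)%N.
Proof.
move=> sM sD; apply: (leq_trans (size_sum _ _ _)).
apply/bigmax_leqP => s _; rewrite size_Msign.
(* A zero entry kills the term; otherwise all sizes are positive and the truncated subtraction in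
   the hypothesis is a genuine one. *)
have [/existsP [i /eqP Mi]|/existsPn M0] := boolP [exists i, M i (s i) == 0].
  by rewrite (bigD1 i) //= Mi mul0r size_poly0.
rewrite size_prod // cardT size_enum_ord.
have : (\sum_i (size (M i (s i)) + s i) <= \sum_i (alpha i).+1)%N.
  have aux a b c : (a <= c - b)%N -> (0 < a)%N -> (a + b <= c)%N by lia.
  by apply: leq_sum => i _; apply: aux (sM i (s i)) _; rewrite size_poly_gt0; exact: M0.
rewrite big_split /= -(reindex_inj (P := predT) (F := fun j : 'I_N => nat_of_ord j) (@perm_inj _ s)) /=.
rewrite [X in (_ <= X)%N](_ : _ = N + \sum_i alpha i)%N; last first.
by under eq_bigr do rewrite -add1n; rewrite big_split /= sum_nat_const card_ord muln1.
move: sD; set x := (\sum_i alpha i)%N; set y := (\sum_i size _)%N; set z := (\sum_(j < N) j)%N.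
rewrite addnC; move: x y z => x y z; lia.
Qed.

Lemma uniq_extend (R : numDomainType) (s : seq R) N : uniq s -> (size s <= N)%N ->
  exists t, uniq (s ++ t) /\ size (s ++ t) = N.
Proof.
move=> us sN; have [m -> {N sN}] : exists m, N = (size s + m)%N.
  by exists (N - size s)%N; rewrite subnKC.
elim: m => [|m [t [ut st]]]; first by exists [::]; rewrite cats0 addn0.
pose z := 1 + \sum_(y <- s ++ t) `|y|.
exists (rcons t z); rewrite -rcons_cat rcons_uniq size_rcons st addnS ut andbT; split=> //.
apply/negP => zs; have : `|z| <= \sum_(y <- s ++ t) `|y|.
  by rewrite (big_rem _ zs) /= lerDl sumr_ge0.
by rewrite ger0_norm ?addr_ge0 ?sumr_ge0 // gerDr ler10.
Qed.

(* The Vandermonde matrix of the null vectors, completed to a square one,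
   makes [size ys] columns divisible by [X - v]. *)
Lemma det_null_vectors (R : numFieldType) N (M : 'M[{poly R}]_N) (v : R) (ys : seq R) :
  uniq ys -> (size ys <= N)%N ->
  (forall y i, y \in ys -> \sum_j (M i j).[v] * y ^+ j = 0) ->
  ('X - v%:P) ^+ size ys %| \det M.
Proof.
move=> uy sy My; have [t [ut st]] := uniq_extend uy sy.
pose a : 'rV[R]_N := \row_l (ys ++ t)`_l.
pose V := Vandermonde N a.
have V0 : \det V != 0.
  rewrite det_Vandermonde; apply/prodf_neq0 => i _; apply/prodf_neq0 => j ij.
  by rewrite !mxE subr_eq0 nth_uniq ?st // gtn_eqF.
pose E := M *m map_mx polyC V.
pose d : 'rV[{poly R}]_N := \row_l (if (l < size ys)%N then 'X - v%:P else 1).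
have EE : E = (\matrix_(i, l) (E i l %/ d 0 l)) *m diag_mx d.
  apply/matrixP => i l; rewrite mul_mx_diag !mxE divpK //.
  case: ifP => ly; last exact: dvd1p.
  rewrite dvdp_XsubCl /root -horner_evalE rmorph_sum /=; apply/eqP.
  rewrite -[RHS](My (ys`_l) i (mem_nth _ ly)); apply: eq_bigr => j _.
  by rewrite horner_evalE hornerM !mxE hornerC nth_cat ly.
have dE : \prod_l d 0 l = ('X - v%:P) ^+ size ys.
  under eq_bigr do rewrite mxE.
  by rewrite -big_mkcond /= -(big_ord_widen _ (fun=> 'X - v%:P) sy) prodr_const card_ord.
have : ('X - v%:P) ^+ size ys %| \det E by rewrite EE det_mulmx det_diag dE dvdp_mull.
by rewrite det_mulmx det_map_mx mulrC mul_polyC dvdpZr.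
Qed.

Lemma sum_mult_lt_size (K : fieldType) (s : seq K) (k : K -> nat) (D : {poly K}) :
  uniq s -> D != 0 -> (forall v, v \in s -> ('X - v%:P) ^+ k v %| D) ->
  (\sum_(v <- s) k v < size D)%N.
Proof.
elim: s D => [|v s IH] D; first by rewrite big_nil size_poly_gt0.
rewrite /= => /andP [vs us] D0 dvd; have /dvdpP [E DE] := dvd v (mem_head _ _).
have E0 : E != 0 by apply: contra_neq D0; rewrite DE => ->; rewrite mul0r.
have : (\sum_(w <- s) k w < size E)%N.
  apply: IH => // w ws; have : ('X - w%:P) ^+ k w %| D by apply: dvd; rewrite inE ws orbT.
  rewrite DE mulrC Gauss_dvdpr // coprimep_expl // coprimep_expr //.
  apply: coprimep_XsubC2; rewrite subr_eq0; by apply: contraNneq vs => ->.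
by move=> lt_E; rewrite big_cons DE size_mul ?expf_neq0 ?polyXsubC_eq0 // size_exp_XsubC addnS addnC ltn_add2r.
Qed.

(** * Bivariate polynomials and common zeros *)

(* Polynomials in (x, y) are represented in {poly {poly R}} with outer variable y. *)
Definition tdeg_le (S : nzRingType) (D : nat) (F : {poly {poly S}}) : Prop :=
  forall k, (size (F`_k)%R <= D.+1 - k)%N.

Section TotalDegree.
Variable S : idomainType.
Implicit Types F G : {poly {poly S}}.

Lemma tdeg_le_leq D E F : (D <= E)%N -> tdeg_le D F -> tdeg_le E F.
Proof. by move=> DE FD k; apply: leq_trans (FD k) _; rewrite leq_sub2r. Qed.

Lemma tdeg_le0 D : tdeg_le D (0 : {poly {poly S}}).
Proof. by move=> k; rewrite coef0 size_poly0. Qed.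

Lemma tdeg_leD D F G : tdeg_le D F -> tdeg_le D G -> tdeg_le D (F + G).
Proof.
move=> FD GD k; rewrite coefD; apply: leq_trans (size_polyD _ _) _.
by rewrite geq_max FD GD.
Qed.

Lemma tdeg_le_sum D (I : Type) (r : seq I) (P : pred I) (F : I -> {poly {poly S}}) :
  (forall i, P i -> tdeg_le D (F i)) -> tdeg_le D (\sum_(i <- r | P i) F i).
Proof. by move=> FD; elim/big_ind: _ => //; [exact: tdeg_le0 | exact: tdeg_leD]. Qed.

Lemma tdeg_leM D E F G : tdeg_le D F -> tdeg_le E G -> tdeg_le (D + E) (F * G).
Proof.
move=> FD GE k; rewrite coefM; apply: leq_trans (size_sum _ _ _) _.
apply/bigmax_leqP => j _; have [->|F0] := eqVneq F`_j 0; first by rewrite mul0r size_poly0.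
have [->|G0] := eqVneq G`_(k - j)%N 0; first by rewrite mulr0 size_poly0.
rewrite size_mul //; have := FD j; have := GE (k - j)%N.
move: F0 G0 (ltn_ord j); rewrite -!size_poly_gt0.
set a := size _; set b := size _; move: a b (nat_of_ord j) => a b c.
lia.
Qed.

Lemma tdeg_leC D (c : S) : tdeg_le D c%:P%:P.
Proof.
move=> [|k]; rewrite coefC ?size_poly0 //= subn0.
by apply: leq_trans (size_polyC_leq1 _) _.
Qed.

Lemma tdeg_le_signM D F (b : bool) : tdeg_le D F -> tdeg_le D ((-1) ^+ b * F).
Proof. by case: b; rewrite ?mul1r // mulN1r => FD k; rewrite coefN size_polyN. Qed.

Lemma tdeg_le_prod (I : Type) (r : seq I) (D : nat) (F : I -> {poly {poly S}}) :
  (forall i, tdeg_le D (F i)) -> tdeg_le (size r * D) (\prod_(i <- r) F i).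
Proof.
move=> FD; elim: r => [|i r IH]; first by rewrite big_nil; exact: tdeg_leC.
by rewrite big_cons mulSn; apply: tdeg_leM.
Qed.

Lemma tdeg_le_det N (M : 'M[{poly {poly S}}]_N) D :
  (forall i j, tdeg_le D (M i j)) -> tdeg_le (N * D) (\det M).
Proof.
move=> MD; apply: tdeg_le_sum => s _; apply: tdeg_le_signM.
have := @tdeg_le_prod _ (index_enum 'I_N) D (fun i => M i (s i)) (fun i => MD i (s i)).
by rewrite (_ : size _ = N) // -sum1_size -[RHS]card_ord -sum1_card; apply: eq_bigl.
Qed.

Lemma tdeg_leX D F (n : nat) : tdeg_le D F -> tdeg_le (n * D) (F ^+ n).
Proof.
move=> FD; elim: n => [|n IH]; first by rewrite expr0; exact: tdeg_leC.
by rewrite exprS mulSn; apply: tdeg_leM.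
Qed.

Lemma tdeg_le_size D F : tdeg_le D F -> (size F <= D.+1)%N.
Proof.
move=> FD; apply/leq_sizeP => k kD; apply/eqP; rewrite -size_poly_leq0.
by apply: leq_trans (FD k) _; rewrite leqn0 subn_eq0.
Qed.

End TotalDegree.

Definition bieval2 (S : comNzRingType) (F : {poly {poly S}}) (x y : S) : S := F.[y%:P].[x].

Definition column (S : comNzRingType) (F : {poly {poly S}}) (x : S) : {poly S} :=
  map_poly (horner_eval x) F.

Lemma bieval2E (S : comNzRingType) (F : {poly {poly S}}) x y :
  bieval2 F x y = (column F x).[y].
Proof.
rewrite /bieval2 /column -[y in RHS](_ : horner_eval x y%:P = y).
  by rewrite horner_map.
exact: hornerC.
Qed.

Section CommonZeros.
Variable R : rcfType.
Implicit Types F G : {poly {poly R}}.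

(** Entry [j] of row [k] in a block is the coefficient of index [j - k], whence the weights [q + k]
    for the rows of [F] and [q.-1 + k] for those of [G]. Their sum exceeds the sum of the column
    indices by exactly [q * q.-1], whatever the degree of [G] in y. *)
Lemma size_resultant_le (q : nat) F G : size F = q.+1 -> (0 < q)%N ->
  tdeg_le q F -> tdeg_le q.-1 G -> (size (resultant F G) <= (q * q.-1).+1)%N.
Proof.
move=> sF q0 FD GD; rewrite /resultant.
pose alpha (i : 'I_((size G).-1 + (size F).-1)) : nat :=
  match fintype.split i with inl k => (q + k)%N | inr k => (q.-1 + k)%N end.
apply: (size_det_weighted (alpha := alpha)) => [i j|].
  rewrite Sylvester_mxE /alpha; case: (fintype.split i) => k; rewrite mulrb;
    case: ifP => kj; rewrite ?size_poly0 //.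
    by apply: leq_trans (FD _) _; move: kj; move: (nat_of_ord j) (nat_of_ord k) => a b; lia.
  apply: leq_trans (GD _) _; move: kj; move: (nat_of_ord j) (nat_of_ord k) => a b. lia.
rewrite !big_split_ord /= /alpha.
under eq_bigr do rewrite (unsplitK (inl _)).
under [X in (_ + X <= _)%N]eq_bigr do rewrite (unsplitK (inr _)).
rewrite !big_split /= !sum_nat_const !card_ord sF /=.
set a := (\sum_(i < (size G).-1) i)%N; set b := (\sum_(i < q) i)%N.
by clearbody a b; nia.
Qed.

(** Common zeros with equal abscissa are not moved apart by a change of coordinates: r of them on
    the line x = v give r null vectors of the Sylvester matrix at v, hence a factor of multiplicity
    r in the resultant. *)
Lemma common_zeros_le (F G : {poly {poly R}}) (q B : nat) (pts : seq (R * R)) :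
  size F = q.+1 -> (forall x, column F x != 0) ->
  resultant F G != 0 -> (size (resultant F G) <= B.+1)%N -> uniq pts ->
  (forall p, p \in pts -> bieval2 F p.1 p.2 = 0 /\ bieval2 G p.1 p.2 = 0) ->
  (size pts <= B)%N.
Proof.
move=> sF F0 res0 sres upts ptsP.
pose ys v := [seq p.2 | p <- pts & p.1 == v].
have uys v : uniq (ys v).
  rewrite map_inj_in_uniq ?filter_uniq // => -[a b] [c d].
  by rewrite !mem_filter /= => /andP [/eqP -> _] /andP [/eqP -> _] ->.
have ysP v y : y \in ys v -> bieval2 F v y = 0 /\ bieval2 G v y = 0.
  by move=> /mapP [p]; rewrite mem_filter => /andP [/eqP <- pp] ->; apply: ptsP.
have dvd v : ('X - v%:P) ^+ size (ys v) %| resultant F G.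
  apply: det_null_vectors => // [|y i /ysP []].
    apply: (@leq_trans q); last by rewrite sF leq_addl.
    rewrite -ltnS -sF; apply: leq_trans (size_poly _ _ : size (column F v) <= _)%N.
    apply: max_poly_roots => //; apply/allP => y /ysP [+ _].
    by rewrite bieval2E => /eqP.
  rewrite !bieval2E => Fy Gy.
  exact: (Sylvester_eval (phi := horner_eval v) i Fy Gy).
have := sum_mult_lt_size (k := fun v => size (ys v)) (undup_uniq [seq p.1 | p <- pts]) res0
  (fun v _ => dvd v).
suff -> : (\sum_(v <- undup [seq p.1 | p <- pts]) size (ys v) = size pts)%N.
  by move=> /leq_trans /(_ sres).
under eq_bigr do rewrite size_map size_filter -sum1_count big_mkcond /=.
rewrite exchange_big /= -[RHS]sum1_size; apply: eq_big_seq => p pp.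
rewrite -big_mkcond /= sum1_count (eq_count (a2 := pred1 p.1)) => [|v /=].
  by rewrite count_uniq_mem ?undup_uniq // mem_undup map_f.
by rewrite eq_sym.
Qed.

End CommonZeros.

(* Total degree q, and y^q occurs: after a shear every nonzero polynomial has this form. *)
Definition y_regular (S : nzRingType) (q : nat) (F : {poly {poly S}}) : Prop :=
  tdeg_le q F /\ exists2 c : S, c != 0 & F`_q = c%:P.

Definition translate_y (S : comNzRingType) (h : S) (F : {poly {poly S}}) : {poly {poly S}} :=
  F \Po ('X + h%:P%:P).

Definition difference_y (S : comNzRingType) (h : S) (F : {poly {poly S}}) : {poly {poly S}} :=
  translate_y h F - F.

Lemma bieval2D (S : comNzRingType) (F G : {poly {poly S}}) x y :
  bieval2 (F + G) x y = bieval2 F x y + bieval2 G x y.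
Proof. by rewrite /bieval2 !hornerD. Qed.

Lemma bieval2M (S : comNzRingType) (F G : {poly {poly S}}) x y :
  bieval2 (F * G) x y = bieval2 F x y * bieval2 G x y.
Proof. by rewrite /bieval2 !hornerM. Qed.

(** * Translation in y and the Bezout bound for gaps of length h *)

Section YRegular.
Variable R : rcfType.
Implicit Types F G : {poly {poly R}}.

Lemma y_regular_size q F : y_regular q F -> size F = q.+1.
Proof.
move=> [FD [c c0 Fq]]; apply/eqP; rewrite eqn_leq tdeg_le_size //= ltnNge.
by apply: contraNN c0 => /leq_sizeP /(_ q (leqnn q)) /eqP; rewrite Fq polyC_eq0.
Qed.

Lemma column_coef F x k : (column F x)`_k = (F`_k).[x].
Proof. by rewrite coef_map. Qed.

Lemma column_size_le F x : (size (column F x) <= size F)%N.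
Proof. exact: size_poly. Qed.

Lemma y_regular_column_neq0 q F x : y_regular q F -> column F x != 0.
Proof.
move=> [_ [c c0 Fq]]; apply: contra_neq c0 => /(congr1 (fun p : {poly R} => p`_q)).
by rewrite column_coef Fq hornerC coef0.
Qed.

Lemma bieval2_translate h F x y : bieval2 (translate_y h F) x y = bieval2 F x (y + h).
Proof. by rewrite /bieval2 horner_comp hornerD hornerX hornerC polyCD. Qed.

Lemma bieval2B F G x y : bieval2 (F - G) x y = bieval2 F x y - bieval2 G x y.
Proof. by rewrite /bieval2 !hornerD !hornerN. Qed.

Lemma column_translate h F x : column (translate_y h F) x = column F x \Po ('X + h%:P).
Proof.
by rewrite /column map_comp_poly rmorphD /= map_polyX map_polyC /= horner_evalE hornerC.
Qed.


Lemma coef_XaddC_exp (h : R) k m : (k <= m)%N -> (('X + h%:P) ^+ k)`_m = (m == k)%:R.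
Proof.
elim: k m => [|k IH] [|m] km //; first by rewrite expr0 coef1.
  by rewrite expr0 coef1.
rewrite exprS mulrDl coefD coefXM coefCM /= !IH //; last exact: leqW.
by rewrite (gtn_eqF (km : (k < m.+1)%N)) mulr0n mulr0 addr0 eqSS.
Qed.

Lemma coef_XaddC_exp_sub (h : R) k : (('X + h%:P) ^+ k.+1)`_k = h *+ k.+1.
Proof.
elim: k => [|k IH]; first by rewrite expr1 coefD coefX coefC add0r.
rewrite exprS mulrDl coefD coefXM coefCM /= IH coef_XaddC_exp // eqxx mulr1.
by rewrite -mulrSr.
Qed.

Lemma difference_yE h F : difference_y h F =
  \sum_(k < size F) F`_k *: map_poly polyC (('X + h%:P) ^+ k - 'X^k).
Proof.
rewrite /difference_y /translate_y comp_polyE [X in _ - X](_ : _ = \sum_(k < size F) F`_k *: 'X^k).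
  rewrite -sumrB; apply: eq_bigr => k _; rewrite -scalerBr; congr (_ *: _).
  by rewrite rmorphB !rmorphXn rmorphD /= map_polyX map_polyC.
by rewrite -{1}[F]coefK poly_def.
Qed.

Lemma coef_difference_y h F m : (difference_y h F)`_m =
  \sum_(k < size F) F`_k * ((('X + h%:P) ^+ k - 'X^k)`_m)%:P.
Proof.
by rewrite difference_yE coef_sum; apply: eq_bigr => k _; rewrite coefZ coef_map.
Qed.

Lemma tdeg_le_difference_y h q F : tdeg_le q F -> tdeg_le q.-1 (difference_y h F).
Proof.
move=> FD m; rewrite coef_difference_y; apply: leq_trans (size_sum _ _ _) _.
apply/bigmax_leqP => k _; have [km|mk] := leqP k m.
  by rewrite coefB coef_XaddC_exp // coefXn subrr mulr0 size_poly0.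
have [->|F0] := eqVneq F`_k 0; first by rewrite mul0r size_poly0.
rewrite mulrC mul_polyC; apply: leq_trans (size_scale_leq _ _) _.
have := FD k; move: F0; rewrite -size_poly_gt0; set a := size _; move: a (nat_of_ord k) mk => a b; lia.
Qed.

(** The resultant specialises to a column when the leading coefficients survive there. The term c
    y^q of [F] contributes c q h y^(q-1) to the difference, with a coefficient that is constant in
    x. *)
Lemma difference_y_lead h q F : (0 < q)%N -> h != 0 -> y_regular q F ->
  exists2 c : R, c != 0 & lead_coef (difference_y h F) = c%:P.
Proof.
case: q => // q _ h0 Freg; have sF := y_regular_size Freg; have [FD [c c0 Fq]] := Freg.
have Gq : (difference_y h F)`_q = (c * (h *+ q.+1))%:P.
  rewrite coef_difference_y sF big_ord_recr /= big1 => [|k _].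
    by rewrite add0r Fq coefB coef_XaddC_exp_sub coefXn ltn_eqF // subr0 polyCM.
  by rewrite coefB coef_XaddC_exp -1?ltnS // coefXn subrr mulr0.
have ch0 : c * (h *+ q.+1) != 0 by rewrite mulf_neq0 // mulrn_eq0.
exists (c * (h *+ q.+1)) => //; rewrite -Gq lead_coefE; congr (_`_ _).
apply/eqP; rewrite eqn_leq -ltnS; apply/andP; split.
  have := tdeg_le_size (tdeg_le_difference_y h FD) => /=.
  by case: (size _) => [|n].
rewrite -ltnS; apply: leq_trans (leqSpred _); rewrite ltnNge; apply: contraNN ch0.
by move=> /leq_sizeP /(_ q (leqnn q)) /eqP; rewrite Gq polyC_eq0.
Qed.

Lemma small_avoids (s : seq R) : exists2 e : R, 0 < e & forall h, 0 < h < e -> h \notin s.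
Proof.
elim: s => [|a s [e e0 IH]]; first by exists 1.
have [a0|a0] := lerP a 0.
  exists e => // h he; rewrite inE negb_or IH // andbT; apply: contraTneq he => ->.
  by rewrite ltNge a0.
exists (Num.min a e); first by rewrite lt_min a0.
move=> h /andP [h0]; rewrite lt_min => /andP [ha he].
by rewrite inE negb_or lt_eqF // IH // h0.
Qed.

(** A common root z over the complex numbers makes z and z + h both roots of [f], so [h] is the real
    part of one of finitely many differences of roots. *)
Lemma small_translate_coprime (f : {poly R}) : f != 0 ->
  exists2 e : R, 0 < e & forall h, 0 < h < e -> coprimep f (f \Po ('X + h%:P) - f).
Proof.
move=> f0; pose C := R[i]%C; pose iota : {rmorphism R -> C} := real_complex R.
have [rs fE] := closed_field_poly_normal (map_poly iota f).
have inrs (z : C) : root (map_poly iota f) z -> z \in rs.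
  rewrite fE rootZ ?root_prod_XsubC //.
  by rewrite lead_coef_eq0 map_poly_eq0.
have [e e0 eP] := small_avoids [seq complex.Re (z.2 - z.1) | z <- [seq (a, b) | a <- rs, b <- rs]].
exists e => // h he; apply: contraNT (eP h he); rewrite /coprimep => gn1.
pose g := gcdp f (f \Po ('X + h%:P) - f).
have [z gz] : exists z, root (map_poly iota g) z.
  by apply/closed_rootP; rewrite size_map_poly.
have rz (k : {poly R}) : g %| k -> root (map_poly iota k) z.
  rewrite -(dvdp_map iota) -dvdp_XsubCl; apply: dvdp_trans.
  by rewrite dvdp_XsubCl.
have fz : root (map_poly iota f) z by apply: rz; exact: dvdp_gcdl.
have : root (map_poly iota (f \Po ('X + h%:P) - f)) z.
  by apply: rz; exact: dvdp_gcdr.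
rewrite rmorphB /= map_comp_poly rmorphD /= map_polyX map_polyC /= rootE hornerD hornerN.
rewrite (rootP fz) subr0 horner_comp hornerD hornerX hornerC => fzh.
apply/mapP; exists (z, z + iota h).
  by apply/allpairsP; exists (z, z + iota h); split=> //; apply: inrs.
by rewrite /= addrC addrA [- _ + _]addrC subrr add0r.
Qed.

(** It suffices to exclude a common factor in one column, here x = 0: a resultant that is nonzero
    after specialisation is nonzero. The threshold for [h] comes from that column alone. *)
Lemma gaps_le q F : y_regular q F -> exists2 e : R, 0 < e &
  forall h (pts : seq (R * R)), 0 < h < e -> uniq pts ->
    (forall p, p \in pts -> bieval2 F p.1 p.2 = 0 /\ bieval2 F p.1 (p.2 + h) = 0) ->
    (size pts <= q * q.-1)%N.
Proof.
move=> Freg; have sF := y_regular_size Freg; have [FD [c c0 Fq]] := Freg.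
have [e e0 eP] := small_translate_coprime (y_regular_column_neq0 0 Freg).
exists e => // h pts he upts ptsP; have [q0|q0] := posnP q.
  case: pts upts ptsP => // p pts _ /(_ p (mem_head _ _)) [Fp _].
  move: Fp c0; rewrite bieval2E (_ : column F p.1 = c%:P) ?hornerC => [->|]; first by rewrite eqxx.
  rewrite q0 in Fq sF; apply/polyP => -[|k]; rewrite column_coef coefC /=.
    by rewrite Fq hornerC.
  by rewrite nth_default ?horner0 // sF.
have h0 : h != 0 by case/andP: he => /gt_eqF ->.
have [d d0 Gl] := difference_y_lead q0 h0 Freg.
apply: (common_zeros_le (G := difference_y h F) sF) => //.
- by move=> x; apply: y_regular_column_neq0 Freg.
- apply/eqP => /(congr1 (horner_eval 0)); rewrite rmorph0 map_resultant.
  + rewrite -/(column F 0) -/(column _ 0) => /eqP; rewrite resultant_eq0 /difference_y.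
    rewrite /column rmorphB /= -!/(column _ _) column_translate ltnNge.
    by have := eP h he; rewrite /coprimep => /eqP ->.
  + by rewrite lead_coefE sF Fq /= horner_evalE hornerC.
  + by rewrite Gl /= horner_evalE hornerC.
- by apply: size_resultant_le => //; apply: tdeg_le_difference_y.
- by move=> p /ptsP [Fp Fph]; rewrite bieval2B bieval2_translate Fp Fph subrr.
Qed.

End YRegular.

(** * Shears and squarefree parts *)

Section Shear.
Variable R : rcfType.
Implicit Types (F : {poly {poly R}}) (p : {poly R}).

Lemma no_root_right p (c : R) : p != 0 ->
  exists2 e : R, 0 < e & forall x, c < x < c + e -> ~~ root p x.
Proof.
move=> p0; pose C := R[i]%C; pose iota : {rmorphism R -> C} := real_complex R.
have [rs pE] := closed_field_poly_normal (map_poly iota p).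
have [e e0 eP] := small_avoids [seq complex.Re z - c | z <- rs].
exists e => // x /andP [cx xe]; apply: contraNN (eP (x - c) _) => [px|]; last first.
  by rewrite subr_gt0 cx ltrBlDl.
apply/mapP; exists (iota x) => //.
have : root (map_poly iota p) (iota x) by rewrite fmorph_root.
by rewrite pE rootZ ?root_prod_XsubC // lead_coef_eq0 map_poly_eq0.
Qed.

Lemma exists_nonroot p : p != 0 -> exists x : R, p.[x] != 0.
Proof.
move=> p0; have [e e0 eP] := no_root_right 0 p0; exists (e / 2).
have := eP (e / 2); rewrite /root; apply.
by rewrite divr_gt0 // add0r ltr_pdivrMr // ltr_pMr // ltr1n.
Qed.

Lemma tdeg_exact F q : F != 0 -> tdeg_le q F ->
  exists q', [/\ (q' <= q)%N, tdeg_le q' F &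
    exists2 k, (k <= q')%N & (F`_k)`_(q' - k)%N != 0].
Proof.
move=> F0; elim: q => [|q IH] FD.
  exists 0%N; split=> //; exists 0%N => //; apply: contra_neq F0 => F00.
  apply/polyP => k; rewrite coef0; apply/eqP; rewrite -size_poly_leq0.
  case: k => [|k]; last by apply: leq_trans (FD _) _.
  apply/leq_sizeP => -[|j] _ //; apply/eqP; have /leq_sizeP -> // := FD 0%N.
have [Fk|nF] := EM (exists2 k, (k <= q.+1)%N & (F`_k)`_(q.+1 - k)%N != 0).
  by exists q.+1.
have [k|q' [q'q F'D Fk]] := IH; last by exists q'; split=> //; apply: leqW.
have [kq|qk] := leqP k q.+1; last by apply: leq_trans (FD k) _; lia.
apply/leq_sizeP => j; rewrite leq_eqVlt => /predU1P [<-|kj].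
  by apply/eqP/negPn/negP => Fk; apply: nF; exists k.
by have /leq_sizeP -> // := FD k; lia.
Qed.

(** The polynomial F(x + l y, y), expanded by monomials; the sums are complete once [q] bounds the
    total degree. *)
Definition shear (F : {poly {poly R}}) (q : nat) (l : R) : {poly {poly R}} :=
  \sum_(k < q.+1) \sum_(i < q.+1)
    ((F`_k)`_i)%:P%:P * ('X%:P + l%:P%:P * 'X) ^+ i * 'X^k.

Lemma bieval2_morphE F x y : bieval2 F x y = (horner_eval x \o horner_eval y%:P) F.
Proof. by []. Qed.

Lemma bieval2_shear F q l x y : tdeg_le q F ->
  bieval2 (shear F q l) x y = bieval2 F (x + l * y) y.
Proof.
move=> FD; rewrite bieval2_morphE rmorph_sum /=.
rewrite /bieval2 (horner_coef_wide _ (tdeg_le_size FD)) -[RHS]horner_evalE rmorph_sum /=.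
apply: eq_bigr => k _; rewrite !rmorph_sum /= !horner_evalE hornerM horner_exp hornerC.
rewrite (horner_coef_wide _ (leq_trans (FD k) (leq_subr _ _))) big_distrl /=.
apply: eq_bigr => i _; rewrite !(horner_evalE, hornerM, horner_exp, hornerD, hornerC, hornerX).
by congr (_ * _ ^+ _ * _); rewrite addrC.
Qed.

Lemma coef_linear_exp (l : R) (i m : nat) : (i <= m)%N ->
  (('X%:P + l%:P%:P * 'X : {poly {poly R}}) ^+ i)`_m = ((m == i)%:R * l ^+ i)%:P.
Proof.
elim: i m => [|i IH] [|m] im //; first by rewrite expr0 coef1 mulr1.
  by rewrite expr0 coef1 mul0r.
rewrite exprS mulrDl coefD coefCM -mulrA coefCM coefXM /= !IH //; last exact: leqW.
rewrite (gtn_eqF (im : (i < m.+1)%N)) mul0r mulr0 add0r -polyCM eqSS exprS.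
by rewrite mulrCA.
Qed.

Lemma shear_y_regular F q : F != 0 -> tdeg_le q F ->
  exists q' l (F' : {poly {poly R}}),
    [/\ (q' <= q)%N, y_regular q' F' &
        forall x y, bieval2 F' x y = bieval2 F (x + l * y) y].
Proof.
move=> F0 FD; have [q' [q'q F'D [k0 k0q Fk0]]] := tdeg_exact F0 FD.
(* [T] at l is the value at (l, 1) of the homogeneous part of degree [q'] of [F]; after the shear it
   is the coefficient of y^q'. *)
pose T : {poly R} := \sum_(k < q'.+1) (F`_k)`_(q' - k)%N *: 'X^(q' - k).
have T0 : T != 0.
  apply: contra_neq Fk0 => /(congr1 (fun p : {poly R} => p`_(q' - k0)%N)).
  rewrite coef0 coef_sum (bigD1 (Ordinal (k0q : (k0 < q'.+1)%N))) //= big1 => [|k kk].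
    by rewrite coefZ coefXn eqxx mulr1 addr0.
  rewrite coefZ coefXn; case: eqP => [E|]; last by rewrite mulr0.
  case/eqP: kk; apply: val_inj => /=; move: E (ltn_ord k).
  by move: (nat_of_ord k) => a; lia.
have [l Tl] := exists_nonroot T0; exists q', l, (shear F q' l); split=> //; last first.
  by move=> x y; apply: bieval2_shear.
have Xd : tdeg_le 1 ('X : {poly {poly R}}).
  move=> [|[|k]]; rewrite coefX ?size_poly0 //= ?size_poly1 //.
have Ld : tdeg_le 1 ('X%:P + l%:P%:P * 'X : {poly {poly R}}).
  apply: tdeg_leD; last by apply: (@tdeg_leM _ 0 1); [exact: tdeg_leC | exact: Xd].
  by move=> [|k]; rewrite coefC ?size_poly0 //= size_polyX.
have F00 k i : (q' < i + k)%N -> (F`_k)`_i = 0.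
  by move=> qik; have /leq_sizeP -> // := F'D k; lia.
split.
  apply: tdeg_le_sum => k _; apply: tdeg_le_sum => i _.
  have [ik|/F00 ->] := leqP (i + k) q'; last by rewrite !mul0r; exact: tdeg_le0.
  apply: (tdeg_le_leq ik); apply: tdeg_leM.
    by have := @tdeg_leM _ 0 i _ _ (tdeg_leC 0 (F`_k)`_i) _; apply;
       have := tdeg_leX i Ld; rewrite muln1.
  by have := tdeg_leX k Xd; rewrite muln1.
exists T.[l] => //; rewrite /shear coef_sum.
rewrite /T -horner_evalE !rmorph_sum /=; apply: eq_bigr => k _.
rewrite horner_evalE hornerZ hornerXn coef_sum.
have kq : (q' - k < q'.+1)%N by rewrite ltnS leq_subr.
rewrite (bigD1 (Ordinal kq)) //= big1 => [|i ik].
  rewrite addr0 coefMXn ltnNge -ltnS ltn_ord /= coefCM coef_linear_exp //.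
  by rewrite eqxx mul1r polyCM.
rewrite coefMXn ltnNge -ltnS ltn_ord /= coefCM.
have [ikq|/F00 ->] := leqP (i + k) q'; last by rewrite mul0r.
rewrite coef_linear_exp; last by rewrite leq_subRL ?(leq_trans _ ikq) ?leq_addl // addnC.
rewrite eq_sym; case: eqP => [E|]; last by rewrite mul0r mulr0.
by case/eqP: ik; apply: val_inj.
Qed.

End Shear.

Section Squarefree.
Variable R : rcfType.
Implicit Types (F : {poly {poly R}}).

(** If [b] did not vanish at [y], then [a] would have the same multiplicity there as [f]; but [a]
    divides a nonzero multiple of the derivative, where that multiplicity is one less. *)
Lemma root_cofactor_gcd (f a b k : {poly R}) (c d y : R) :
  f != 0 -> c != 0 -> d != 0 -> c *: f = b * a -> d *: f^`() = k * a ->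
  root f y -> root b y.
Proof.
move=> f0 c0 d0 fE fE' fy; apply/negPn/negP => by0.
have f'0 : f^`() != 0.
  by rewrite -size_poly_gt0 size_deriv -ltnS prednK ?size_poly_gt0 // (root_size_gt1 f0 fy).
have mu_scale (t : R) (g : {poly R}) : t != 0 -> g != 0 -> \mu_y (t *: g) = \mu_y g.
  by move=> t0 g0; rewrite -mul_polyC mu_mul ?mu_polyC ?mulf_neq0 ?polyC_eq0.
have ba0 : b * a != 0 by rewrite -fE scaler_eq0 negb_or c0.
have ka0 : k * a != 0 by rewrite -fE' scaler_eq0 negb_or d0.
have mE : \mu_y f = \mu_y a by rewrite -(mu_scale c) // fE mu_mul // (muNroot by0).
have := mu_scale _ _ d0 f'0; rewrite fE' mu_mul // -mE mu_deriv //.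
by have := mu_gt0 y f0; rewrite fy; move: (\mu_y f) (\mu_y k) => m n; lia.
Qed.

Lemma column_deriv F x : column F^`() x = (column F x)^`().
Proof. by rewrite /column deriv_map. Qed.

(* Dividing by the gcd with the y-derivative keeps the zero set in all but
   finitely many columns. *)
Lemma squarefree_part F : F != 0 -> exists (e : {poly R}) (B : {poly {poly R}}),
  e != 0 /\ forall x, e.[x] != 0 ->
    (forall y, root (column F x) y = root (column B x) y) /\
    (forall y, root (column B x) y -> ~~ root (column B x)^`() y).
Proof.
have [n] := ubnP (size F); elim: n F => // n IH F; rewrite ltnS => sF F0.
have [F1|F1] := leqP (size F) 1.
  have E : F = (F`_0)%:P by apply: size1_polyC.
  exists F`_0, F; split=> [|x ex]; first by rewrite -polyC_eq0 -E.
  have colE y : root (column F x) y = false.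
    by rewrite E /column map_polyC /= /root hornerC horner_evalE (negbTE ex).
  by split=> // y; rewrite colE.
have sd : (0 < (size F^`()).-1 + (size F).-1)%N by rewrite addn_gt0 -(subn1 (size F)) subn_gt0 F1 orbT.
have [res0|res0] := eqVneq (resultant F F^`()) 0; last first.
  (* In a column where this resultant is nonzero, [F] and its y-derivative have no common root. *)
  exists (resultant F F^`()), F; split=> // x ex; split=> // y /rootP Fy.
  apply: contraNN ex => /rootP F'y; apply/eqP.
  by apply: (resultant_common_root (phi := horner_eval x) sd Fy); rewrite -/(column _ _) column_deriv.
have /Pdiv.Idomain.dvdpP [[c B] /= c0 FE] := dvdp_gcdl F F^`().
have /Pdiv.Idomain.dvdpP [[d K] /= d0 F'E] := dvdp_gcdr F F^`().
move/eqP: res0; rewrite resultant_eq0; set A := gcdp _ _ in FE F'E * => sA.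
have A0 : A != 0 by rewrite -size_poly_gt0 ltnW.
have B0 : B != 0.
  apply: contra_neq F0 => B0; have /eqP : c *: F = 0 by rewrite FE B0 mul0r.
  by rewrite -mul_polyC mulf_eq0 polyC_eq0 (negbTE c0) => /eqP.
have [|e [B1 [e0 eP]]] := IH B _ B0.
  apply: leq_trans sF; rewrite -(size_scale F c0) FE size_mul //.
  by move: sA; move: (size A) (size B) => a b; case: a => [|[|a]] // _; rewrite !addnS /= ltnS leq_addr.
(* [c] and [d] are the denominators of the two pseudo-divisions. The leading coefficient keeps the
   column of [F] nonzero, so that its roots have multiplicities. *)
exists (e * c * d * lead_coef F), B1; split=> [|x].
  by rewrite !mulf_neq0 ?lead_coef_eq0.
rewrite !hornerM !mulf_eq0 !negb_or => /andP [/andP [/andP [ex cx] dx] lx].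
have [E1 E2] := eP x ex; split=> // y; rewrite -E1.
have colZ (u : {poly R}) (G : {poly {poly R}}) : column (u *: G) x = u.[x] *: column G x.
  by rewrite /column map_polyZ.
have colM (G H : {poly {poly R}}) : column (G * H) x = column G x * column H x.
  by rewrite /column rmorphM.
have fE : c.[x] *: column F x = column B x * column A x by rewrite -colZ FE colM.
have fE' : d.[x] *: (column F x)^`() = column K x * column A x.
  by rewrite -column_deriv -colZ F'E colM.
have f0 : column F x != 0.
  apply: contra_neq lx => /(congr1 (fun p : {poly R} => p`_(size F).-1)).
  by rewrite column_coef coef0.
apply/idP/idP => [|By]; first exact: root_cofactor_gcd fE fE'.
by rewrite -(rootZ y (column F x) cx) fE rootM By.
Qed.

End Squarefree.
Local Open Scope classical_set_scope.

(** * Vertical gaps of the regions *)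

Section Continuity.
Variable R : realType.
Implicit Types (F : {poly {poly R}}) (p : {poly R}).

Lemma horner_fst_continuous p : continuous (fun z : R * R => p.[z.1]).
Proof.
elim/poly_ind: p => [|p c IH] z.
  by under eq_fun do rewrite horner0; exact: cvg_cst.
under eq_fun do rewrite hornerMXaddC.
apply: cvgD; last exact: cvg_cst.
by apply: cvgM; [exact: IH | exact: cvg_fst].
Qed.

Lemma bieval2_continuous F : continuous (fun z : R * R => bieval2 F z.1 z.2).
Proof.
elim/poly_ind: F => [|F p IH] z.
  by under eq_fun do rewrite /bieval2 !horner0; exact: cvg_cst.
under eq_fun do rewrite /bieval2 hornerMXaddC hornerD hornerM hornerC.
apply: cvgD; last exact: horner_fst_continuous.
by apply: cvgM; [exact: IH | exact: cvg_snd].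
Qed.

Lemma bieval2_gt0_near F x y : 0 < bieval2 F x y ->
  exists2 e : R, 0 < e & forall x' y', x - e < x' -> x' < x + e -> y - e < y' -> y' < y + e ->
    0 < bieval2 F x' y'.
Proof.
move=> Fxy; have : \forall z \near (x, y), 0 < bieval2 F z.1 z.2.
  exact: (cvgr_gt _ (@bieval2_continuous F (x, y)) 0 Fxy).
move=> /nbhs_ballP [e /= e0 He]; exists e => // x' y' x1 x2 y1 y2.
apply: (He (x', y')); split; rewrite /ball /= ltr_norml; lra.
Qed.

Lemma bieval2_neq0_near F x y : bieval2 F x y != 0 ->
  exists2 e : R, 0 < e & forall x' y', x - e < x' -> x' < x + e -> y - e < y' -> y' < y + e ->
    bieval2 F x' y' != 0.
Proof.
move=> Fxy; have sqE u v : bieval2 (F * F) u v = bieval2 F u v ^+ 2.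
  by rewrite /bieval2 !hornerM.
have : 0 < bieval2 (F * F) x y by rewrite sqE exprn_even_gt0.
move=> /bieval2_gt0_near [e e0 He]; exists e => // x' y' x1 x2 y1 y2.
by have := He x' y' x1 x2 y1 y2; rewrite sqE exprn_even_gt0.
Qed.

Lemma horner_gt0_near p x : 0 < p.[x] ->
  exists2 e : R, 0 < e & forall x', x - e < x' -> x' < x + e -> 0 < p.[x'].
Proof.
have pE u v : bieval2 p%:P u v = p.[u] by rewrite /bieval2 hornerC.
rewrite -(pE x 0) => /bieval2_gt0_near [e e0 He]; exists e => // x' x1 x2.
by rewrite -(pE x' 0); apply: He => //; lra.
Qed.

(** Compactness of the interval, stated for an arbitrary relation [Q] so that tubes, cluster values
    and bounds on zeros all follow from it. *)
Lemma segment_covering (Q : R -> R -> Prop) (a b : R) :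
  (forall y, a <= y -> y <= b -> exists2 e, 0 < e &
     forall d y', 0 < d -> d < e -> y - e < y' -> y' < y + e -> Q d y') ->
  exists2 e, 0 < e & forall d y, 0 < d -> d < e -> a <= y -> y <= b -> Q d y.
Proof.
move=> HQ; have /compact_near_coveringP near_cov := @segment_compact R a b.
have : \forall d \near nbhs (0 : R), `[a, b]%classic `<=` (fun y => 0 < d -> Q d y).
  apply: near_cov => y /=; rewrite in_itv /= => /andP [ay yb].
  have [e e0 He] := HQ y ay yb; exists (ball y e, ball 0 e).
    by split; apply: nbhsx_ballx.
  move=> [y' d] [] /=; rewrite /ball /= !ltr_norml => /andP [y1 y2] /andP [d1 d2] d0.
  by apply: He => //; lra.
move=> /nbhs_ballP [e /= e0 He]; exists e => // d y d0 de ay yb.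
apply: (He d) => //; first by rewrite /ball /= ltr_norml; lra.
by rewrite /= in_itv /= ay.
Qed.

Lemma tube F x (a b : R) :
  (forall y, a <= y -> y <= b -> bieval2 F x y != 0) ->
  exists2 e, 0 < e & forall x' y, x - e < x' -> x' < x + e -> a <= y -> y <= b ->
    bieval2 F x' y != 0.
Proof.
move=> HF; have [|e e0 He] := @segment_covering
    (fun d y => forall x', x - d < x' -> x' < x + d -> bieval2 F x' y != 0) a b.
  move=> y ay yb; have [e e0 He] := bieval2_neq0_near (HF y ay yb).
  by exists e => // d y' d0 de y1 y2 x' x1 x2; apply: He => //; lra.
exists (e / 2); first by lra.
by move=> x' y x1 x2 ay yb; apply: (He (e / 2)) => //; lra.
Qed.

Lemma cluster_right (P : R -> R -> Prop) (x a b : R) :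
  (forall d, 0 < d -> exists x' y, [/\ x <= x', x' < x + d, a <= y, y <= b & P x' y]) ->
  exists y0, forall d, 0 < d ->
    exists x' y, [/\ x <= x', x' < x + d, y0 - d < y, y < y0 + d & P x' y].
Proof.
move=> HP; apply: contrapT => nH.
have [|e e0 He] := @segment_covering
    (fun d y => forall x', x <= x' -> x' < x + d -> ~ P x' y) a b.
  move=> y ay yb; apply: contrapT => nHe; apply: nH; exists y => d d0.
  apply: contrapT => nP; apply: nHe; exists d => // d' y' d'0 d'd y1 y2 x' x1 x2 Pxy.
  by apply: nP; exists x', y'; split=> //; lra.
have [|x' [y [x1 x2 ay yb]]] := HP (e / 2); first by lra.
by apply: (He (e / 2)) => //; lra.
Qed.

(** Putting y = 1/s turns [F] into s^-q times a polynomial [G] whose value at s = 0 is the nonzero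
    constant [c]; by compactness [G] has no zero with s small over the whole of [a, b]. *)
Lemma y_regular_root_bound q F (a b : R) : y_regular q F ->
  exists2 M, 0 < M & forall x y, a <= x -> x <= b -> M < `|y| -> bieval2 F x y != 0.
Proof.
move=> Freg; have sF := y_regular_size Freg; have [_ [c c0 Fq]] := Freg.
pose G : {poly {poly R}} := \poly_(k < q.+1) F`_(q - k)%N.
have GE x y : y != 0 -> bieval2 F x y = bieval2 G x y^-1 * y ^+ q.
  move=> y0; rewrite !bieval2E (horner_coef_wide _ (leq_trans (column_size_le _ _) (eq_leq sF))).
  rewrite (@horner_coef_wide _ q.+1 (column G x)); last first.
    exact: leq_trans (column_size_le _ _) (size_poly _ _).
  rewrite big_distrl /= (reindex_inj rev_ord_inj) /=; apply: eq_bigr => k _.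
  rewrite !column_coef coef_poly subSS ltn_ord -mulrA; congr (_ * _).
  have kq : (k <= q)%N by rewrite -ltnS.
  have -> : y ^+ q = y ^+ (q - k) * y ^+ k by rewrite -exprD subnK.
  by rewrite exprVn mulrC mulfK // expf_neq0.
have G0 x : bieval2 G x 0 != 0.
  by rewrite bieval2E horner_coef0 column_coef coef_poly subn0 Fq hornerC.
have [|e e0 He] := @segment_covering
    (fun d x => forall s, - d < s -> s < d -> bieval2 G x s != 0) a b.
  move=> x ax xb; have [e e0 He] := bieval2_neq0_near (G0 x).
  by exists e => // d x' d0 de x1 x2 s s1 s2; apply: He => //; lra.
exists (2 / e) => [|x y ax xb My]; first by rewrite divr_gt0.
have y0 : y != 0 by rewrite -normr_gt0 (lt_trans _ My) // divr_gt0.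
rewrite GE // mulf_neq0 ?expf_neq0 //.
have : `|y^-1| < e / 2.
  rewrite normfV -[e / 2]invrK ltf_pV2 ?posrE ?invr_gt0 ?divr_gt0 ?normr_gt0 //.
  by rewrite invf_div.
rewrite ltr_norml => /andP [s1 s2].
by apply: (He (e / 2)) => //; lra.
Qed.

Lemma infimum_approx (S : R -> Prop) (m x0 : R) : S x0 -> (forall x, S x -> m <= x) ->
  exists c, [/\ m <= c, forall x, S x -> c <= x &
    forall d, 0 < d -> exists2 x, S x & x < c + d].
Proof.
move=> Sx0 Sm; have hi : has_inf [set x | S x] by split; [exists x0 | exists m].
exists (inf [set x | S x]); split.
- by apply: lb_le_inf; [exists x0 | move=> x /Sm].
- by move=> x Sx; apply: ge_inf => //; exists m.
- by move=> d d0; have [x Sx xd] := inf_adherent d0 hi; exists x.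
Qed.

End Continuity.

(* What the counting argument uses of a connected component of [F != 0]. *)
Record region (R : realType) (F : {poly {poly R}}) (Om : R -> R -> Prop) : Prop := Region {
  region_neq0 : forall x y, Om x y -> bieval2 F x y != 0;
  region_hor : forall x x' y, Om x y ->
    (forall u, Num.min x x' <= u -> u <= Num.max x x' -> bieval2 F u y != 0) -> Om x' y;
  region_ver : forall x y y', Om x y ->
    (forall u, Num.min y y' <= u -> u <= Num.max y y' -> bieval2 F x u != 0) -> Om x y';
  region_cross : forall x1 y1 x2 y2 c, Om x1 y1 -> Om x2 y2 -> x1 <= c -> c <= x2 ->
    exists y, Om c y }.

Section RegionTheory.
Variables (R : realType) (F : {poly {poly R}}) (Om : R -> R -> Prop).
Hypothesis OmF : region F Om.

Lemma region_open x y : Om x y -> exists2 e : R, 0 < e &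
  forall x' y', x - e < x' -> x' < x + e -> y - e < y' -> y' < y + e -> Om x' y'.
Proof.
move=> Oxy; have [e e0 He] := bieval2_neq0_near (region_neq0 OmF Oxy).
exists e => // x' y' x1 x2 y1 y2.
have Ox'y : Om x' y.
  apply: (region_hor OmF Oxy) => u.
  by rewrite /Num.min /Num.max /Order.min /Order.max; case: ifP => _ u1 u2; apply: He; lra.
apply: (region_ver OmF Ox'y) => u.
by rewrite /Num.min /Num.max /Order.min /Order.max; case: ifP => _ u1 u2; apply: He; lra.
Qed.

Lemma region_limit x y : bieval2 F x y != 0 ->
  (forall d, 0 < d -> exists x' y',
     [/\ x - d < x', x' < x + d, y - d < y', y' < y + d & Om x' y']) -> Om x y.
Proof.
move=> Fxy near; have [e e0 He] := bieval2_neq0_near Fxy.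
have [x' [y' [x1 x2 y1 y2 Oxy']]] := near e e0.
have Oxy : Om x y'.
  apply: (region_hor OmF Oxy') => u.
  by rewrite /Num.min /Num.max /Order.min /Order.max; case: ifP => _ u1 u2; apply: He; lra.
apply: (region_ver OmF Oxy) => u.
by rewrite /Num.min /Num.max /Order.min /Order.max; case: ifP => _ u1 u2; apply: He; lra.
Qed.

Lemma region_segment_left x y1 y2 : (forall u, y1 <= u -> u <= y2 -> Om x u) ->
  exists2 x', x' < x & forall u, y1 <= u -> u <= y2 -> Om x' u.
Proof.
move=> Ox; have [|e e0 He] := @tube R F x y1 y2.
  by move=> u u1 u2; apply: (region_neq0 OmF); apply: Ox.
exists (x - e / 2) => [|u u1 u2]; first by lra.
apply: (region_hor OmF (Ox u u1 u2)) => v.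
by rewrite /Num.min /Num.max /Order.min /Order.max; case: ifP => _ v1 v2; apply: He => //; lra.
Qed.

(** If one end were not a zero, the open segment could be slid slightly past that end, and a closed
    segment of length [h] would lie in [Om]. *)
Lemma region_gap_endpoints x y h : 0 < h -> (forall u, y < u -> u < y + h -> Om x u) ->
  (forall y', ~ forall u, y' <= u -> u <= y' + h -> Om x u) ->
  bieval2 F x y = 0 /\ bieval2 F x (y + h) = 0.
Proof.
move=> h0 inner no_seg; split; apply/eqP/negPn/negP => F0;
  have [k k0 Hk] := bieval2_neq0_near F0;
  have [t [t0 th tk]] : exists t : R, [/\ 0 < t, t < h & t < k]
    by exists (Num.min h k / 2); rewrite /Num.min /Order.min; case: ifP => ?; split; lra.
- apply: (no_seg (y - t)) => u u1 u2; have [yu|uy] := ltrP y u; first by apply: inner; lra.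
  apply: (region_ver OmF (inner (y + t) _ _)) => [||v]; [lra|lra|].
  by rewrite /Num.min /Num.max /Order.min /Order.max; case: ifP => _ v1 v2; apply: Hk; lra.
- apply: (no_seg (y + t)) => u u1 u2; have [yu|uy] := ltrP u (y + h).
    by apply: inner; lra.
  apply: (region_ver OmF (inner (y + h - t) _ _)) => [||v]; [lra|lra|].
  by rewrite /Num.min /Num.max /Order.min /Order.max; case: ifP => _ v1 v2; apply: Hk; lra.
Qed.

End RegionTheory.

Lemma simple_root_sign_change (R : realType) (p : {poly R}) (z d : R) :
  root p z -> ~~ root p^`() z -> 0 < d ->
  exists t, [/\ 0 < t, t < d & p.[z - t] * p.[z + t] < 0].
Proof.
move=> /factor_theorem [g pE] p'z d0.
have gz : g.[z] != 0.
  by move: p'z; rewrite /root pE derivM derivXsubC !hornerE subrr mulr0 add0r.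
have : 0 < (g.[z] *: g).[z] by rewrite hornerZ -expr2 exprn_even_gt0.
move=> /horner_gt0_near [e e0 He].
have [t [t0 td te]] : exists t : R, [/\ 0 < t, t < d & t < e].
  by exists (Num.min d e / 2); rewrite /Num.min /Order.min; case: ifP => ?; split; lra.
exists t; split=> //; rewrite pE !hornerM !hornerXsubC.
have g1 : 0 < g.[z] * g.[z - t] by rewrite -hornerZ; apply: He; lra.
have g2 : 0 < g.[z] * g.[z + t] by rewrite -hornerZ; apply: He; lra.
have : 0 < g.[z - t] * g.[z + t].
  by rewrite -(pmulr_rgt0 _ (_ : 0 < g.[z] ^+ 2)) ?exprn_even_gt0 // expr2 mulrACA mulr_gt0.
have -> : g.[z - t] * (z - t - z) * (g.[z + t] * (z + t - z)) = - (g.[z - t] * g.[z + t]) * t ^+ 2.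
  by ring.
by move=> g3; rewrite mulNr oppr_lt0 mulr_gt0 // exprn_gt0.
Qed.

(** A simple zero is a sign change; the signs just below and above it persist in nearby columns by
    continuity, and the intermediate value theorem finds a zero between them. *)
Lemma simple_zero_persists (R : realType) (B : {poly {poly R}}) (x z d : R) :
  root (column B x) z -> ~~ root (column B x)^`() z -> 0 < d ->
  exists2 e, 0 < e & forall x', x - e < x' -> x' < x + e ->
    exists w, [/\ z - d < w, w < z + d & root (column B x') w].
Proof.
move=> Bz B'z d0; have [t [t0 td Bt]] := simple_root_sign_change Bz B'z d0.
pose p : {poly R} := - (B.[(z - t)%:P] * B.[(z + t)%:P]).
have pE u : p.[u] = - ((column B u).[z - t] * (column B u).[z + t]).
  by rewrite hornerN hornerM -!bieval2E.
have [|e e0 He] := @horner_gt0_near R p x; first by rewrite pE oppr_gt0.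
exists e => // x' x1 x2; have Bneg : (column B x').[z - t] * (column B x').[z + t] < 0.
  by rewrite -oppr_gt0 -pE; apply: He.
have [|w] := poly_ivtoo _ Bneg; first by lra.
by rewrite in_itv /= => /andP [w1 w2] Bw; exists w; split=> //; lra.
Qed.

(* The infimum of the abscissas of vertical segments of length h contained in
   Om is realised by a gap of length exactly h: such a segment could otherwise be
   moved further left.  No zero can appear inside the limit segment, because in
   that column the zeros of F are sign changes of B and so persist nearby. *)
Lemma region_left_gap (R : realType) (F B : {poly {poly R}}) (e : {poly R}) (q : nat)
    (Om : R -> R -> Prop) (m xs ys : R) :
  y_regular q F -> e != 0 ->
  (forall x, e.[x] != 0 ->
    (forall y, root (column F x) y = root (column B x) y) /\
    (forall y, root (column B x) y -> ~~ root (column B x)^`() y)) ->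
  region F Om -> Om xs ys -> (forall x y, Om x y -> m <= x) ->
  exists2 h0 : R, 0 < h0 & forall h, 0 < h -> h < h0 ->
    exists x y, [/\ x < xs, bieval2 F x y = 0, bieval2 F x (y + h) = 0 & Om x (y + h / 2)].
Proof.
move=> Freg e0 eP OmF Os Om_m.
have [||c0 [_ c0_le c0_near]] := @infimum_approx R (fun x => exists y, Om x y) m xs.
- by exists ys.
- by move=> x [y /Om_m].
have c0_lt x y : Om x y -> c0 < x.
  move=> Oxy; have [d d0 Hd] := region_open OmF Oxy.
  have /c0_le : exists y', Om (x - d / 2) y' by exists y; apply: Hd; lra.
  by lra.
(* All columns used below lie strictly between [c0] and [c0 + d], where [e] has no root and [B]
   therefore describes the zeros of [F]. *)
have [d d0 noroot] := no_root_right c0 e0.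
have c0s := c0_lt _ _ Os.
have [x1 [[y1 O1] x1s x1d]] : exists x1, [/\ exists y1, Om x1 y1, x1 < xs & x1 < c0 + d].
  have [|x1 Ox1] := c0_near (Num.min (xs - c0) d); first by rewrite lt_min d0 subr_gt0 c0s.
  by move=> lt_x1; exists x1; split=> //; move: lt_x1; rewrite /Num.min /Order.min; case: ifP; lra.
have c01 := c0_lt _ _ O1.
(* A box in [Om] around ([x1], [y1]) supplies a vertical segment of every length below [h0], so the
   infimum [xh] below is taken over a nonempty set. *)
have [h0 h0_gt0 Hh0] := region_open OmF O1; exists h0 => // h h_gt0 h_lt.
pose seg x y := forall u, y <= u -> u <= y + h -> Om x u.
have [||xh [c0xh xh_le xh_near]] := @infimum_approx R (fun x => x <= x1 /\ exists y, seg x y) c0 x1.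
- by split=> //; exists y1 => u u1 u2; apply: Hh0; lra.
- by move=> x [_ [y /(_ y)]] Oxy; apply: c0_le; exists y; apply: Oxy; lra.
have xh1 : xh <= x1.
  by apply: xh_le; split=> //; exists y1 => u u1 u2; apply: Hh0; lra.
have no_seg y : ~ seg xh y.
  move=> /(region_segment_left OmF) [x' x'xh sx'].
  have : xh <= x' by apply: xh_le; split; [exact: ltW (lt_le_trans x'xh xh1) | exists y].
  by rewrite leNgt x'xh.
have [M M0 HM] := y_regular_root_bound (c0 - 1) x1 Freg.
(* Above [M] and below [- M] there are no zeros over the strip from [c0 - 1] to [x1], so a point of
   [Om] there could slide left beyond the infimum [c0]. *)
have Om_bounded x y : Om x y -> x <= x1 -> `|y| <= M.
  move=> Oxy xx1; rewrite leNgt; apply/negP => My; have c0x := c0_lt _ _ Oxy.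
  have : Om (c0 - 1) y; last by move=> /c0_lt; lra.
  apply: (region_hor OmF Oxy) => u.
  by rewrite /Num.min /Num.max /Order.min /Order.max; case: ifP => _ u1 u2; apply: HM => //; lra.
have [|yh star] := @cluster_right R (fun x y => x <= x1 /\ seg x y) xh (- M) M.
  move=> k k0; have [x [xx1 [y sy]] xk] := xh_near k k0; exists x, y.
  have := Om_bounded x y _ xx1; rewrite ler_norml => /(_ _) /andP [|yM1 yM2].
    by apply: sy; lra.
  by split=> //; apply: xh_le; split=> //; exists y.
have inOm u : 0 <= u -> u <= h -> bieval2 F xh (yh + u) != 0 -> Om xh (yh + u).
  move=> u0 uh Fu; apply: (region_limit OmF Fu) => k k0.
  have [x [y [xx1 xx2 y2 y3 [_ sy]]]] := star k k0.
  exists x, (y + u); have Oxyu : Om x (y + u) by apply: sy; rewrite ?lerDl // lerD2l.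
  by split=> //; [apply: lt_le_trans xx1; rewrite gtrBl | rewrite addrAC ltrD2r
    | rewrite addrAC ltrD2r].
(* The column [xh] has finitely many zeros, so a point of the limit segment just above [yh] is not a
   zero; it lies in [Om], whose abscissas all exceed [c0]. *)
have c0_xh : c0 < xh.
  have [k k0 Hk] := no_root_right yh (y_regular_column_neq0 xh Freg).
  have hk0 : 0 < Num.min h k by rewrite lt_min h_gt0.
  have [hkh hkk] : Num.min h k <= h /\ Num.min h k <= k by rewrite !ge_min !lexx orbT.
  have [u0 uh uk] : [/\ 0 < Num.min h k / 2, Num.min h k / 2 < h & Num.min h k / 2 < k].
    by move: (Num.min h k) hk0 hkh hkk => z; clear; split; lra.
  apply: (c0_lt _ (yh + Num.min h k / 2)); apply: inOm; rewrite ?ltW // bieval2E.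
  by apply: Hk; rewrite ltrDl u0 ltrD2l.
have e_neq0 x : xh <= x -> x <= x1 -> e.[x] != 0.
  by move=> xhx xx1; apply: noroot; rewrite (lt_le_trans c0_xh xhx) (le_lt_trans xx1 x1d).
have inner u : yh < u -> u < yh + h -> Om xh u.
  move=> yhu uyh; rewrite -[u](subrKC yh); apply: inOm; rewrite ?subrKC ?subr_ge0 ?lerBlDl ?ltW //.
  apply/negP => /eqP Fu.
  have [FB Bsimple] := eP xh (e_neq0 xh (lexx _) xh1).
  have Bu : root (column B xh) u by rewrite -FB /root -bieval2E Fu.
  (* Half the distance from [u] to the nearer end: the perturbed zero moves by less than [d1] and
     the segment shifts by at most [d1], so the zero stays in the segment. *)
  pose d1 := Num.min (u - yh) (yh + h - u) / 2.
  have [d10 d11 d12] : [/\ 0 < d1, d1 + d1 <= u - yh & d1 + d1 <= yh + h - u].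
    have : 0 < Num.min (u - yh) (yh + h - u) by rewrite lt_min !subr_gt0 yhu.
    by rewrite -splitr !ge_min !lexx orbT => ?; split=> //; rewrite divr_gt0.
  have [k k0 Hk] := simple_zero_persists Bu (Bsimple u Bu) d10.
  have [l [l0 lk ld]] : exists l : R, [/\ 0 < l, l <= k & l <= d1].
    by exists (Num.min k d1); rewrite lt_min k0 d10 !ge_min !lexx orbT.
  have [x [y [xx1 xx2 yy1 yy2 [xlex1 sy]]]] := star l l0.
  have [||w [w1 w2 Bw]] := Hk x.
  - by apply: lt_le_trans xx1; rewrite gtrBl.
  - by apply: lt_le_trans xx2 _; rewrite lerD2l.
  have [FBx _] := eP x (e_neq0 x xx1 xlex1).
  have Oxw : Om x w.
    by apply: sy; move: d11 d12 ld yy1 yy2 w1 w2; clear; move: d1 => d1; lra.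
  by have := region_neq0 OmF Oxw; rewrite bieval2E; move: Bw; rewrite -FBx /root => ->.
have [F1 F2] := region_gap_endpoints OmF h_gt0 inner no_seg.
exists xh, yh; split=> //; first exact: le_lt_trans xh1 x1s.
by apply: inner; rewrite ?ltrDl ?divr_gt0 // ltrD2l gtr_pMr // invf_lt1 // ltr1n.
Qed.

(** * Counting the regions *)

(** The number of roots below [y k] grows strictly with [y k] over [A], so it determines [k]; with
    fewer than [size p] roots it takes at most [size p] values. *)
Lemma card_separated_by_roots (R : rcfType) (p : {poly R}) (I : finType) (A : {pred I})
    (y : I -> R) : p != 0 -> (forall k, k \in A -> ~~ root p (y k)) ->
  (forall k l, k \in A -> l \in A -> k != l -> y k <= y l ->
     exists2 r, y k <= r <= y l & root p r) ->
  (#|A| <= size p)%N.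
Proof.
move=> p0 yroot sep; pose s := rootsR p.
have mem_s x : (x \in s) = root p x by rewrite /s -roots_on_rootsR // in_itv.
have size_s : (size s < size p)%N.
  apply: max_poly_roots => //; last exact: uniq_roots.
  by apply/allP => x; rewrite mem_s.
pose below k := count (fun r => r < y k) s.
have lt_below k l : k \in A -> l \in A -> k != l -> y k <= y l -> (below k < below l)%N.
  move=> kA lA kl ykl; have [r /andP [kr rl] pr] := sep k l kA lA kl ykl.
  have lt_kr : y k < r.
    by rewrite lt_neqAle kr andbT; apply: contraNneq (yroot k kA) => ->.
  have lt_rl : r < y l.
    by rewrite lt_neqAle rl andbT; apply: contraNneq (yroot l lA) => <-.
  have nil : count (predI (fun r => r < y k) (pred1 r)) s = 0%N.
    apply/eqP; rewrite -leqn0 leqNgt -has_count; apply/hasPn => x _ /=.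
    by case: eqVneq => [->|_]; rewrite ?andbF // ltNge (ltW lt_kr).
  have : (0 < count_mem r s)%N by rewrite -has_count has_pred1 mem_s.
  have : (count (predU (fun r => (r < y k)%R) (pred1 r)) s <= below l)%N.
    by apply: sub_count => x /= /orP [/lt_le_trans->//|/eqP ->].
  have := count_predUI (fun r => (r < y k)%R) (pred1 r) s; rewrite nil /below.
  by move: (count _ _) (count _ _) (count _ _) (count _ _) => a b c d; lia.
have below_lt k : (below k < (size s).+1)%N by rewrite ltnS count_size.
rewrite (leq_trans (@leq_card_in _ 'I_(size s).+1 (fun k => Ordinal (below_lt k)) A _)) ?card_ord //.
move=> k l kA lA /(congr1 val) /= kl; apply/eqP/negPn/negP => nkl.
have [ykl|/ltW ylk] := lerP (y k) (y l); first by have := lt_below k l kA lA nkl ykl; rewrite kl ltnn.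
by have := lt_below l k lA kA; rewrite eq_sym nkl ylk kl ltnn => /(_ isT isT).
Qed.

Lemma small_forall (R : realFieldType) (I : finType) (P : I -> R -> Prop) :
  (forall i, exists2 h0, 0 < h0 & forall h, 0 < h -> h < h0 -> P i h) ->
  exists2 h0, 0 < h0 & forall h, 0 < h -> h < h0 -> forall i, P i h.
Proof.
move=> HP; suff [h0 h00 H] : exists2 h0, 0 < h0 &
    forall h, 0 < h -> h < h0 -> forall i, i \in enum I -> P i h.
  by exists h0 => // h hh hh0 i; apply: H => //; rewrite mem_enum.
elim: (enum I) => [|i s [h1 h10 H1]]; first by exists 1.
have [h2 h20 H2] := HP i; exists (Num.min h1 h2); first by rewrite lt_min h10.
move=> h hh; rewrite lt_min => /andP [lt1 lt2] j.
by rewrite inE => /predU1P [->|js]; [exact: H2 | exact: H1].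
Qed.

Section Count.
Variable R : realType.
Implicit Types F : {poly {poly R}}.

Definition reflect_x F : {poly {poly R}} := map_poly (comp_poly (- 'X)) F.

Lemma bieval2_reflect F x y : bieval2 (reflect_x F) x y = bieval2 F (- x) y.
Proof.
rewrite !bieval2E; congr (_.[_]); apply/polyP => k.
by rewrite !column_coef coef_map /= horner_comp hornerN hornerX.
Qed.

Lemma y_regular_reflect q F : y_regular q F -> y_regular q (reflect_x F).
Proof.
move=> [FD [c c0 Fq]]; split; last by exists c; rewrite // coef_map /= Fq comp_polyC.
move=> k; rewrite coef_map /= size_comp_poly2 ?FD //.
by rewrite size_polyN size_polyX.
Qed.

Lemma region_reflect F Om : region F Om -> region (reflect_x F) (fun x y => Om (- x) y).
Proof.
move=> [H0 Hh Hv Hc]; split.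
- by move=> x y /H0; rewrite bieval2_reflect.
- move=> x x' y Oxy Fu; apply: Hh Oxy _ => u u1 u2.
  rewrite -[u]opprK -bieval2_reflect; apply: Fu; move: u1 u2;
    rewrite /Num.min /Num.max /Order.min /Order.max; do 2!case: ifP; lra.
- move=> x y y' Oxy Fu; apply: Hv Oxy _ => u u1 u2.
  by rewrite -bieval2_reflect; apply: Fu.
- move=> x1 y1 x2 y2 c O1 O2 x1c cx2.
  by apply: (Hc (- x2) y2 (- x1) y1) => //; rewrite lerN2.
Qed.

(** [L] collects the regions with abscissas bounded below. The threshold for [h] is common to all of
    them, since their gaps must be zeros of one system with one [h]. *)
Lemma left_ends F (q n : nat) (Om : 'I_n -> R -> R -> Prop) (px py : 'I_n -> R) :
  y_regular q F -> (forall k, region F (Om k)) -> (forall k, Om k (px k) (py k)) ->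
  (forall k l x y, Om k x y -> Om l x y -> k = l) ->
  exists L : {pred 'I_n}, (#|[predC L]| <= q.+1)%N /\
    exists2 h0 : R, 0 < h0 & forall h, 0 < h -> h < h0 ->
      exists g : 'I_n -> R * R, forall k, k \in L ->
        [/\ (g k).1 < px k, bieval2 F (g k).1 (g k).2 = 0,
            bieval2 F (g k).1 ((g k).2 + h) = 0 & Om k (g k).1 ((g k).2 + h / 2)].
Proof.
move=> Freg OmF Omp Om_inj.
pose bounded k := `[< exists m, forall x y, Om k x y -> m <= x >].
exists bounded; split.
  (* This column is left of every chosen point: a region without lower bound has points on both
     sides of it and, being connected, meets it. The roots of the column polynomial, of size at most
     [q.+1], separate these regions. *)
  pose x0 := - (1 + \sum_k `|px k|).
  have x0_lt k : x0 <= px k.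
    have : `|px k| <= \sum_k `|px k| by rewrite (bigD1 k) //= lerDl sumr_ge0.
    by have := ler_norm (- px k); rewrite normrN /x0; lra.
  have ycol k : exists y, k \in [predC bounded] -> Om k x0 y.
    have [kb|kb] := boolP (k \in [predC bounded]); last by exists 0.
    have [x [y [Oxy xx0]]] : exists x y, Om k x y /\ x < x0.
      apply: contrapT => nO; move: kb; rewrite !inE => /asboolP; apply.
      exists x0 => x y Oxy; rewrite leNgt; apply/negP => xx0; apply: nO.
      by exists x, y.
    have [y' Oy'] := region_cross (OmF k) Oxy (Omp k) (ltW xx0) (x0_lt k).
    by exists y'.
  have [y yP] := choice ycol.
  rewrite -(y_regular_size Freg).
  apply: leq_trans (column_size_le F x0).
  apply: (card_separated_by_roots (y := y)); first exact: y_regular_column_neq0 Freg.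
    by move=> k /yP /(region_neq0 (OmF k)); rewrite bieval2E.
  move=> k l kb lb kl ykl; apply: contrapT => noroot.
  have : Om k x0 (y l).
    apply: (region_ver (OmF k) (yP k kb)) => u.
    rewrite (min_idPl ykl) (max_idPr ykl) => u1 u2.
    rewrite bieval2E; apply/negP => ru; apply: noroot; exists u => //; by rewrite u1.
  by move=> /Om_inj /(_ (yP l lb)) /eqP; rewrite (negbTE kl).
have [|e [B [e0 eP]]] := @squarefree_part R F.
  by rewrite -size_poly_gt0 (y_regular_size Freg).
have [|h0 h00 H] := @small_forall R _ (fun k h => k \in bounded -> exists z : R * R,
    [/\ z.1 < px k, bieval2 F z.1 z.2 = 0, bieval2 F z.1 (z.2 + h) = 0 & Om k z.1 (z.2 + h / 2)]).
  move=> k; have [kb|kb] := boolP (k \in bounded); last by exists 1.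
  have [m Om_m] : exists m, forall x y, Om k x y -> m <= x by apply/asboolP.
  have [h0 h00 H] := region_left_gap Freg e0 eP (OmF k) (Omp k) Om_m.
  by exists h0 => // h hh hh0 _; have [x [y Hxy]] := H h hh hh0; exists (x, y).
exists h0 => // h hh hh0.
have gex k : exists z : R * R, k \in bounded -> [/\ z.1 < px k, bieval2 F z.1 z.2 = 0,
    bieval2 F z.1 (z.2 + h) = 0 & Om k z.1 (z.2 + h / 2)].
  have [kb|kb] := boolP (k \in bounded); last by exists (0, 0).
  by have [z zP] := H h hh hh0 k kb; exists z.
have [g gP] := choice gex.
by exists g.
Qed.

Lemma region_count F (q n : nat) (Om : 'I_n -> R -> R -> Prop) (px py : 'I_n -> R) :
  y_regular q F -> (forall k, region F (Om k)) -> (forall k, Om k (px k) (py k)) ->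
  (forall k l x y, Om k x y -> Om l x y -> k = l) ->
  (2 * n <= q * q.-1 + 2 * q.+1)%N.
Proof.
move=> Freg OmF Omp Om_inj.
have [L [cL [hL hL0 HL]]] := left_ends Freg OmF Omp Om_inj.
have [||||L' [cL' [hL' hL'0 HL']]] := @left_ends (reflect_x F) q n
  (fun k x y => Om k (- x) y) (fun k => - px k) py.
- exact: y_regular_reflect.
- by move=> k; apply: region_reflect.
- by move=> k; rewrite opprK.
- by move=> k l x y; apply: Om_inj.
have [e e0 eP] := gaps_le Freg.
pose h := Num.min e (Num.min hL hL') / 2.
have [h0 he hhL hhL'] : [/\ 0 < h, h < e, h < hL & h < hL'].
  have : 0 < Num.min e (Num.min hL hL') by rewrite !lt_min e0 hL0.
  have : Num.min e (Num.min hL hL') <= e by rewrite ge_min lexx.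
  have : Num.min e (Num.min hL hL') <= hL by rewrite !ge_min lexx orbT.
  have : Num.min e (Num.min hL hL') <= hL' by rewrite !ge_min lexx !orbT.
  by rewrite /h; move: (Num.min _ _) => z; split; lra.
have [g gP] := HL h h0 hhL; have [g' gP'] := HL' h h0 hhL'.
pose f k : R * R := g k; pose f' k : R * R := (- (g' k).1, (g' k).2).
have f'P k : k \in L' -> [/\ px k < (f' k).1, bieval2 F (f' k).1 (f' k).2 = 0,
    bieval2 F (f' k).1 ((f' k).2 + h) = 0 & Om k (f' k).1 ((f' k).2 + h / 2)].
  by move=> /gP' []; rewrite !bieval2_reflect ltrNr => *; split.
(* No point is repeated: the midpoint of a gap determines [k], and the left and right gaps of one
   region lie on opposite sides of [px k]. So all ends are charged to one bound [q * q.-1]. *)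
pose pts := [seq f k | k <- enum L] ++ [seq f' k | k <- enum L'].
have sz : (size pts <= q * q.-1)%N.
  apply: (eP h) => //; first by rewrite h0.
    rewrite cat_uniq !map_inj_in_uniq ?enum_uniq /= ?andbT; first last.
    - move=> k l; rewrite !mem_enum => /gP [_ _ _ Ok] /gP [_ _ _ Ol] kl.
      by apply: Om_inj Ok _; rewrite -/(f k) kl.
    - move=> k l; rewrite !mem_enum => /f'P [_ _ _ Ok] /f'P [_ _ _ Ol] kl.
      by apply: Om_inj Ok _; rewrite kl.
    apply/hasPn => _ /mapP [l + ->]; rewrite mem_enum => /f'P [ltl _ _ Ol].
    apply/mapP => -[k + kl]; rewrite mem_enum => /gP [ltk _ _ Ok].
    have E : k = l by apply: Om_inj Ok _; rewrite -/(f k) -kl.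
    by move: ltl; rewrite kl -E /f ltNge (ltW ltk).
  move=> p; rewrite mem_cat => /orP [] /mapP [k + ->]; rewrite mem_enum.
    by move=> /gP [].
  by move=> /f'P [].
move: sz; rewrite size_cat !size_map -!cardE.
have := cardC L; have := cardC L'; rewrite card_ord; move: cL cL'.
move: #|[predC L]| #|[predC L']| #|L| #|L'| => a b c d.
lia.
Qed.

End Count.

(** * Connected components of the nonzero set as regions *)

Section Components.
Variable R : realType.
Implicit Types (F : {poly {poly R}}) (U : set (R * R)).

Lemma connected_component_path U (f : R -> R * R) (a b u v : R) : continuous f ->
  a <= u -> u <= b -> a <= v -> v <= b -> (forall s, a <= s -> s <= b -> U (f s)) ->
  connected_component U (f u) (f v).
Proof.
move=> fc au ub av vb fU; apply: (@connected_component_max _ _ (f @` `[a, b])).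
- by exists u => //=; rewrite in_itv /= au.
- by move=> _ [s /= + <-]; rewrite in_itv /= => /andP [a_s sb]; apply: fU.
- apply: connected_continuous_connected; last exact: continuous_subspaceT.
  by apply/connected_intervalP; exact: interval_is_interval.
- by exists v => //=; rewrite in_itv /= av.
Qed.

Lemma affine_continuous (c0 c1 d0 d1 : R) :
  continuous (fun s : R => (c0 + c1 * s, d0 + d1 * s)).
Proof.
move=> s; have affine (c d : R) : (c + d * t) @[t --> s] --> c + d * s.
  by apply: cvgD; [exact: cvg_cst | apply: cvgM; [exact: cvg_cst | exact: cvg_id]].
exact: (cvg_pair (affine c0 c1) (affine d0 d1)).
Qed.

Definition nonzero_set F : set (R * R) := [set z | bieval2 F z.1 z.2 != 0].

(** Moves along rows and columns of the sheared plane are straight segments in the original one. For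
    the last field of [region], the sheared abscissa is x - l y, and the image of a connected set
    under it is an interval. *)
Lemma component_region F F' (l : R) (z : R * R) :
  (forall x y, bieval2 F' x y = bieval2 F (x + l * y) y) ->
  region F' (fun x y => connected_component (nonzero_set F) z (x + l * y, y)).
Proof.
move=> FF'; split.
- by move=> x y /connected_component_sub; rewrite FF'.
- move=> x x' y Oxy Fu; apply: (connected_component_trans Oxy).
  have fE s : (s + l * y, y) = (l * y + 1 * s, y + 0 * s) :> R * R.
    by congr (_, _); ring.
  rewrite !fE; apply: (connected_component_path (f := fun s => (l * y + 1 * s, y + 0 * s))
    (a := Num.min x x') (b := Num.max x x')).
  + exact: affine_continuous.
  + by rewrite ge_min lexx.
  + by rewrite le_max lexx.
  + by rewrite ge_min lexx orbT.
  + by rewrite le_max lexx orbT.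
  + by move=> s s1 s2; rewrite -fE /nonzero_set /= -FF'; apply: Fu.
- move=> x y y' Oxy Fu; apply: (connected_component_trans Oxy).
  have fE s : (x + l * s, s) = (x + l * s, 0 + 1 * s) :> R * R.
    by congr (_, _); ring.
  rewrite !fE; apply: (connected_component_path (f := fun s => (x + l * s, 0 + 1 * s))
    (a := Num.min y y') (b := Num.max y y')).
  + exact: affine_continuous.
  + by rewrite ge_min lexx.
  + by rewrite le_max lexx.
  + by rewrite ge_min lexx orbT.
  + by rewrite le_max lexx orbT.
  + by move=> s s1 s2; rewrite -fE /nonzero_set /= -FF'; apply: Fu.
- move=> x1 y1 x2 y2 c O1 O2 x1c cx2; set C := connected_component _ _ in O1 O2 *.
  pose f (w : R * R) := w.1 - l * w.2.
  have fc : continuous f.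
    move=> w; apply: cvgB; first exact: cvg_fst.
    by apply: cvgM; [exact: cvg_cst | exact: cvg_snd].
  have /connected_intervalP itv : connected (f @` C).
    apply: connected_continuous_connected; last exact: continuous_subspaceT.
    exact: component_connected.
  have fE x y : f (x + l * y, y) = x by rewrite /f /= addrK.
  have [|||w Cw wc] := itv x1 x2 _ _ c; last by exists w.2; rewrite -wc /f subrK -surjective_pairing.
  + by exists (x1 + l * y1, y1).
  + by exists (x2 + l * y2, y2).
  + by rewrite x1c.
Qed.

Lemma components_count F (q n : nat) (z : 'I_n -> R * R) : F != 0 -> tdeg_le q F ->
  (forall k, nonzero_set F (z k)) ->
  (forall k l, connected_component (nonzero_set F) (z k) (z l) -> k = l) ->
  (n <= (q ^ 2 + q + 2) %/ 2)%N.
Proof.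
move=> F0 FD Fz z_inj; have [q' [l [F' [q'q F'reg FF']]]] := shear_y_regular F0 FD.
pose Om k x y := connected_component (nonzero_set F) (z k) (x + l * y, y).
have := @region_count R F' q' n Om (fun k => (z k).1 - l * (z k).2) (fun k => (z k).2) F'reg.
move=> /(_ (fun k => component_region (z k) FF')) count.
have {count} : (2 * n <= q' * q'.-1 + 2 * q'.+1)%N.
  apply: count => [k|k m x y Ok Om'].
    by rewrite /Om subrK -surjective_pairing; apply: connected_component_refl.
  by apply: z_inj; apply: (connected_component_trans Ok); exact: connected_component_sym.
(* The sheared polynomial may have a smaller degree [q']; [q' * q'.-1 + 2 * q'.+1] equals
   [q' ^ 2 + q' + 2], which grows with [q']. *)
rewrite leq_divRL // => n_le; rewrite mulnC (leq_trans n_le) //.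
by case: q' q'q {F'reg n_le} => [|q'] q'q /=; nia.
Qed.

Lemma nonzero_point F x y d : F != 0 -> 0 < d ->
  exists x' y', [/\ x < x', x' < x + d, y < y', y' < y + d & bieval2 F x' y' != 0].
Proof.
move=> F0 d0; have [|e1 e10 H1] := @no_root_right R (lead_coef F) x; first by rewrite lead_coef_eq0.
pose x' := x + Num.min d e1 / 2.
have m10 : 0 < Num.min d e1 by rewrite lt_min d0.
have [m11 m12] : Num.min d e1 <= d /\ Num.min d e1 <= e1 by rewrite !ge_min !lexx orbT.
have lx' : (lead_coef F).[x'] != 0 by apply: H1; rewrite /x'; lra.
have col0 : column F x' != 0.
  apply: contra_neq lx' => /(congr1 (fun p : {poly R} => p`_(size F).-1)).
  by rewrite column_coef coef0.
have [e2 e20 H2] := no_root_right y col0.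
pose y' := y + Num.min d e2 / 2.
have m20 : 0 < Num.min d e2 by rewrite lt_min d0.
have [m21 m22] : Num.min d e2 <= d /\ Num.min d e2 <= e2 by rewrite !ge_min !lexx orbT.
exists x', y'; rewrite bieval2E; split; rewrite /x' /y'; [lra|lra|lra|lra|].
by apply: H2; lra.
Qed.

End Components.
Local Open Scope complex_scope.

(** * The border of the D-decomposition *)

Section TrivariateEvaluation.
Variable R : realType.
Implicit Types T : {poly {poly {poly R}}}.

Definition bieval2_morphism (x y : R) : {rmorphism {poly {poly R}} -> R} :=
  (horner_eval x \o horner_eval y%:P)%FUN.

Definition trieval T (x y w : R) : R := (map_poly (bieval2_morphism x y) T).[w].

Lemma trieval_wide T n x y w : (size T <= n)%N ->
  trieval T x y w = \sum_(i < n) bieval2 T`_i x y * w ^+ i.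
Proof.
move=> sT; rewrite /trieval (horner_coef_wide _ (leq_trans (size_poly _ _) sT)).
by apply: eq_bigr => i _; rewrite coef_map.
Qed.

Lemma trieval_continuous T : continuous (fun z : (R * R) * R => trieval T z.1.1 z.1.2 z.2).
Proof.
elim/poly_ind: T => [|T p IH] z.
  by under eq_fun do rewrite /trieval rmorph0 horner0; exact: cvg_cst.
under eq_fun do rewrite /trieval rmorphD rmorphM /= map_polyX map_polyC hornerMXaddC.
apply: cvgD; first by apply: cvgM; [exact: IH | exact: cvg_snd].
apply: (@cvg_comp _ _ _ (fun z : (R * R) * R => z.1) (fun z : R * R => bieval2 p z.1 z.2)).
  exact: cvg_fst.
exact: bieval2_continuous.
Qed.

Lemma trieval_neq0_near T x y w : trieval T x y w != 0 ->
  exists2 e : R, 0 < e & forall x' y' w', x - e < x' -> x' < x + e -> y - e < y' -> y' < y + e ->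
    w - e < w' -> w' < w + e -> trieval T x' y' w' != 0.
Proof.
move=> Txy; have : \forall z \near ((x, y), w), trieval T z.1.1 z.1.2 z.2 != 0.
  exact: (cvgr_neq0 _ (@trieval_continuous T (x, y, w)) Txy).
move=> /nbhs_ballP [e /= e0 He]; exists e => // x' y' w' x1 x2 y1 y2 w1 w2.
by apply: (He ((x', y'), w')); do 2?split; rewrite /ball /= ltr_norml; lra.
Qed.

Lemma trieval_tube T x y (a b : R) :
  (forall w, a <= w -> w <= b -> trieval T x y w != 0) ->
  exists2 e, 0 < e & forall x' y' w, x - e < x' -> x' < x + e -> y - e < y' -> y' < y + e ->
    a <= w -> w <= b -> trieval T x' y' w != 0.
Proof.
move=> HT; have [|e e0 He] := @segment_covering R
    (fun d w => forall x' y', x - d < x' -> x' < x + d -> y - d < y' -> y' < y + d ->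
       trieval T x' y' w != 0) a b.
  move=> w aw wb; have [e e0 He] := trieval_neq0_near (HT w aw wb).
  by exists e => // d w' d0 de w1 w2 x' y' x1 x2 y1 y2; apply: He => //; lra.
exists (e / 2); first by lra.
by move=> x' y' w x1 x2 y1 y2 aw wb; apply: (He (e / 2)) => //; lra.
Qed.

(** Reversal with respect to the formal degree [t]: w = infinity becomes w = 0, and a drop of the
    degree below [t] becomes a zero there. *)
Definition reverse_poly (t : nat) T : {poly {poly {poly R}}} := \poly_(k < t.+1) T`_(t - k)%N.

Lemma trieval_reverse t T x y w : (size T <= t.+1)%N -> w != 0 ->
  trieval T x y w = trieval (reverse_poly t T) x y w^-1 * w ^+ t.
Proof.
move=> sT w0; rewrite (trieval_wide _ _ _ sT) (@trieval_wide _ t.+1) ?size_poly //.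
rewrite big_distrl /= (reindex_inj rev_ord_inj) /=; apply: eq_bigr => k _.
rewrite coef_poly subSS ltn_ord -mulrA; congr (_ * _).
have kt : (k <= t)%N by rewrite -ltnS.
have -> : w ^+ t = w ^+ (t - k) * w ^+ k by rewrite -exprD subnK.
by rewrite exprVn mulrC mulfK // expf_neq0.
Qed.

Lemma trieval_reverse0 t T x y : trieval (reverse_poly t T) x y 0 = bieval2 T`_t x y.
Proof. by rewrite /trieval horner_coef0 coef_map /= coef_poly subn0. Qed.

Lemma trievalD T T' x y w : trieval (T + T') x y w = trieval T x y w + trieval T' x y w.
Proof. by rewrite /trieval rmorphD hornerD. Qed.

Lemma trievalM T T' x y w : trieval (T * T') x y w = trieval T x y w * trieval T' x y w.
Proof. by rewrite /trieval rmorphM hornerM. Qed.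

(* For |w| >= 1 pass to 1/w and the reversed polynomials, so that compactness
   of [-1, 1] suffices. *)
Lemma no_common_root_near (t : nat) (A B : {poly {poly {poly R}}}) x y :
  (size A <= t.+1)%N -> (size B <= t.+1)%N ->
  (forall w, ~ (trieval A x y w = 0 /\ trieval B x y w = 0)) ->
  ~ (bieval2 A`_t x y = 0 /\ bieval2 B`_t x y = 0) ->
  exists2 e, 0 < e & forall x' y', x - e < x' -> x' < x + e -> y - e < y' -> y' < y + e ->
    (forall w, ~ (trieval A x' y' w = 0 /\ trieval B x' y' w = 0)) /\
    ~ (bieval2 A`_t x' y' = 0 /\ bieval2 B`_t x' y' = 0).
Proof.
move=> sA sB AB ABt.
(* Over the reals a common zero of [P] and [Q] is a zero of the sum of their squares, so tubes for a
   single polynomial suffice. *)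
have sumE (P Q : {poly {poly {poly R}}}) u v w :
    (trieval (P * P + Q * Q) u v w == 0) = (trieval P u v w == 0) && (trieval Q u v w == 0).
  by rewrite trievalD !trievalM -!expr2 paddr_eq0 ?sqr_ge0 // !sqrf_eq0.
pose A' := reverse_poly t A; pose B' := reverse_poly t B.
have [|e1 e10 H1] := @trieval_tube (A * A + B * B) x y (-1) 1.
  by move=> w _ _; rewrite sumE; apply/negP => /andP [/eqP Aw /eqP Bw]; apply: (AB w).
have [|e2 e20 H2] := @trieval_tube (A' * A' + B' * B') x y (-1) 1.
  move=> w _ _; rewrite sumE; apply/negP => /andP [/eqP Aw /eqP Bw].
  have [w0|w0] := eqVneq w 0.
    by apply: ABt; move: Aw Bw; rewrite w0 !trieval_reverse0.
  apply: (AB w^-1); rewrite (trieval_reverse _ _ sA) ?(trieval_reverse _ _ sB) ?invr_neq0 // invrK.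
  by rewrite -/A' -/B' Aw Bw !mul0r.
exists (Num.min e1 e2) => [|x' y' x1 x2 y1 y2]; first by rewrite lt_min e10.
have [m1 m2] : Num.min e1 e2 <= e1 /\ Num.min e1 e2 <= e2 by rewrite !ge_min !lexx orbT.
have {}H1 w : -1 <= w -> w <= 1 -> trieval (A * A + B * B) x' y' w != 0.
  by move=> w1 w2; apply: H1 => //; lra.
have {}H2 w : -1 <= w -> w <= 1 -> trieval (A' * A' + B' * B') x' y' w != 0.
  by move=> w1 w2; apply: H2 => //; lra.
split=> [w [Aw Bw]|[At Bt]]; last first.
  by have /negP := H2 0 (lerN10 R) ler01; rewrite sumE !trieval_reverse0 At Bt eqxx.
have [w1|w1] := lerP `|w| 1.
  move: w1; rewrite ler_norml => /andP [w1 w2].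
  by have /negP := H1 w w1 w2; rewrite sumE Aw Bw eqxx.
have w0 : w != 0 by rewrite -normr_gt0 (lt_trans _ w1).
have : `|w^-1| <= 1 by rewrite normfV invf_le1 ?ltW // (lt_trans _ w1).
rewrite ler_norml => /andP [v1 v2]; have /negP := H2 _ v1 v2; rewrite sumE.
move: Aw Bw; rewrite (trieval_reverse _ _ sA w0) (trieval_reverse _ _ sB w0).
move=> /eqP; rewrite mulf_eq0 expf_eq0 (negbTE w0) andbF orbF => -> /eqP.
by rewrite mulf_eq0 expf_eq0 (negbTE w0) andbF orbF => ->.
Qed.

End TrivariateEvaluation.

(** * Real and imaginary parts of P(jw) and the border polynomial *)

Section Border.
Variable R : realType.
Local Notation C := (R[i]).
Implicit Types (f : {poly {poly C}}) (a : nat -> {poly {poly C}}).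

Lemma bieval2_map_linear (rho : {additive C -> R}) f (x y : R) :
  (forall (c : C) (u : R), rho (c * u%:C) = rho c * u) ->
  bieval2 (map_poly (map_poly rho) f) x y = rho (bieval f x y).
Proof.
move=> rhoZ; have rhoX (c : C) (u : R) k : rho (c * u%:C ^+ k) = rho c * u ^+ k.
  by rewrite -rmorphXn /= rhoZ.
have map_horner (p : {poly C}) (u : R) : (map_poly rho p).[u] = rho p.[u%:C].
  rewrite (horner_coef_wide _ (size_poly _ _)) horner_coef raddf_sum.
  by apply: eq_bigr => i _; rewrite coef_map_id0 ?raddf0 // rhoX.
have -> : bieval2 (map_poly (map_poly rho) f) x y =
    \sum_(k < size f) (map_poly rho f`_k).[x] * y ^+ k.
  rewrite /bieval2 (horner_coef_wide _ (size_poly _ _)) horner_sum.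
  apply: eq_bigr => k _; rewrite coef_map_id0 ?map_poly0 //.
  by rewrite hornerM horner_exp hornerC.
rewrite /bieval [f.[_]]horner_coef horner_sum raddf_sum; apply: eq_bigr => k _.
by rewrite hornerM horner_exp hornerC rhoX map_horner.
Qed.

Definition jRe (i : nat) (c : C) : R := @complex.Re R ('i ^+ i * c).
Definition jIm (i : nat) (c : C) : R := @complex.Im R ('i ^+ i * c).

Lemma jRe_additive i : additive (jRe i).
Proof. by move=> c d; rewrite /jRe mulrBr raddfB. Qed.
Lemma jIm_additive i : additive (jIm i).
Proof. by move=> c d; rewrite /jIm mulrBr raddfB. Qed.
HB.instance Definition _ i := GRing.isAdditive.Build C R (jRe i) (jRe_additive i).
HB.instance Definition _ i := GRing.isAdditive.Build C R (jIm i) (jIm_additive i).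

Lemma Re_mulC (c : C) (u : R) : complex.Re (c * u%:C) = complex.Re c * u.
Proof. by case: c => p q /=; rewrite mulr0 subr0. Qed.

Lemma Im_mulC (c : C) (u : R) : complex.Im (c * u%:C) = complex.Im c * u.
Proof. by case: c => p q /=; rewrite mulr0 add0r. Qed.

Lemma jRe_mulC i (c : C) (u : R) : jRe i (c * u%:C) = jRe i c * u.
Proof. by rewrite /jRe mulrA Re_mulC. Qed.

Lemma jIm_mulC i (c : C) (u : R) : jIm i (c * u%:C) = jIm i c * u.
Proof. by rewrite /jIm mulrA Im_mulC. Qed.

Lemma ReP_coef t a i : (i <= t)%N -> (ReP_jw t a)`_i = map_poly (map_poly (jRe i)) (a i).
Proof. by move=> it; rewrite coef_poly ltnS it. Qed.

Lemma ImP_coef t a i : (i <= t)%N -> (ImP_jw t a)`_i = map_poly (map_poly (jIm i)) (a i).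
Proof. by move=> it; rewrite coef_poly ltnS it. Qed.

Lemma bieval2_ReP t a i x y : (i <= t)%N ->
  bieval2 (ReP_jw t a)`_i x y = complex.Re ('i ^+ i * bieval (a i) x y).
Proof.
by move=> it; rewrite ReP_coef // (bieval2_map_linear (rho := jRe i)) //; exact: jRe_mulC.
Qed.

Lemma bieval2_ImP t a i x y : (i <= t)%N ->
  bieval2 (ImP_jw t a)`_i x y = complex.Im ('i ^+ i * bieval (a i) x y).
Proof.
by move=> it; rewrite ImP_coef // (bieval2_map_linear (rho := jIm i)) //; exact: jIm_mulC.
Qed.

Lemma Peval_jw t a x y (w : R) : Peval t a ('i * w%:C) x y =
  \sum_(i < t.+1) ('i ^+ i * bieval (a i) x y) * (w ^+ i)%:C.
Proof.
by apply: eq_bigr => i _; rewrite exprMn rmorphXn /= mulrA [bieval _ _ _ * _]mulrC.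
Qed.

Lemma trieval_ReP t a x y w : trieval (ReP_jw t a) x y w = complex.Re (Peval t a ('i * w%:C) x y).
Proof.
rewrite (trieval_wide _ _ _ (size_poly _ _)) Peval_jw raddf_sum /=.
apply: eq_bigr => i _; have it : (i <= t)%N by rewrite -ltnS.
rewrite (bieval2_ReP _ _ _ it); exact/esym/Re_mulC.
Qed.

Lemma trieval_ImP t a x y w : trieval (ImP_jw t a) x y w = complex.Im (Peval t a ('i * w%:C) x y).
Proof.
rewrite (trieval_wide _ _ _ (size_poly _ _)) Peval_jw raddf_sum /=.
apply: eq_bigr => i _; have it : (i <= t)%N by rewrite -ltnS.
rewrite (bieval2_ImP _ _ _ it); exact/esym/Im_mulC.
Qed.

Lemma complex_eq0 (c : C) : c = 0 <-> complex.Re c = 0 /\ complex.Im c = 0.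
Proof. by case: c => p q /=; split=> [[-> ->]|[-> ->]]. Qed.

Lemma DborderE t a z : Dborder t a z <->
  (exists w, trieval (ReP_jw t a) z.1 z.2 w = 0 /\ trieval (ImP_jw t a) z.1 z.2 w = 0) \/
  (bieval2 (ReP_jw t a)`_t z.1 z.2 = 0 /\ bieval2 (ImP_jw t a)`_t z.1 z.2 = 0).
Proof.
have rootE w : Peval t a ('i * w%:C) z.1 z.2 = 0 <->
    trieval (ReP_jw t a) z.1 z.2 w = 0 /\ trieval (ImP_jw t a) z.1 z.2 w = 0.
  by rewrite trieval_ReP trieval_ImP; exact: complex_eq0.
have leadE : bieval (a t) z.1 z.2 = 0 <->
    bieval2 (ReP_jw t a)`_t z.1 z.2 = 0 /\ bieval2 (ImP_jw t a)`_t z.1 z.2 = 0.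
  rewrite bieval2_ReP // bieval2_ImP // -complex_eq0.
  split=> [->|/eqP]; first by rewrite mulr0.
  by rewrite mulf_eq0 expf_eq0 (negbTE (neq0Ci _)) andbF => /eqP.
split=> [[[w /rootE]|/leadE]|[[w /rootE]|/leadE]].
- by left; exists w.
- by right.
- by left; exists w.
- by right.
Qed.

Lemma tdeg_le_map (rho : {additive C -> R}) f d : (totdeg f <= d)%N ->
  tdeg_le d (map_poly (map_poly rho) f).
Proof.
move=> fd k; rewrite coef_map_id0 ?map_poly0 //; apply: leq_trans (size_poly _ _) _.
have [->|fk0] := eqVneq f`_k 0; first by rewrite size_poly0.
have kf : (k < size f)%N by rewrite ltnNge; apply: contraNN fk0 => ?; rewrite nth_default.
have : (k + (size (f`_k)%R).-1 <= d)%N.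
  apply: leq_trans fd; rewrite /totdeg.
  exact: (@leq_bigmax_cond _ (fun j : 'I_(size f) => f`_j != 0)
    (fun j => j + (size (f`_j)%R).-1)%N (Ordinal kf)).
by move: fk0; rewrite -size_poly_gt0; set s := size _; move: s => s; lia.
Qed.

Lemma tdeg_le_ReP t a i : tdeg_le (Pdeg_rp t a) (ReP_jw t a)`_i.
Proof.
have [it|ti] := leqP i t; last by rewrite coef_poly ltnS leqNgt ti; exact: tdeg_le0.
by rewrite ReP_coef //; apply: tdeg_le_map; exact: (@leq_bigmax _ (fun j : 'I_t.+1 => totdeg (a j)) (Ordinal (it : (i < t.+1)%N))).
Qed.

Lemma tdeg_le_ImP t a i : tdeg_le (Pdeg_rp t a) (ImP_jw t a)`_i.
Proof.
have [it|ti] := leqP i t; last by rewrite coef_poly ltnS leqNgt ti; exact: tdeg_le0.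
by rewrite ImP_coef //; apply: tdeg_le_map; exact: (@leq_bigmax _ (fun j : 'I_t.+1 => totdeg (a j)) (Ordinal (it : (i < t.+1)%N))).
Qed.

Lemma lead_ReP_ImP_neq0 t a : a t != 0 -> ((ReP_jw t a)`_t != 0) || ((ImP_jw t a)`_t != 0).
Proof.
apply: contraNT; rewrite negb_or !negbK => /andP [/eqP Re0 /eqP Im0].
apply/eqP/polyP => k; apply/polyP => i; rewrite !coef0.
have : 'i ^+ t * (a t)`_k`_i = 0 :> C.
  apply/complex_eq0; split.
    move: Re0 => /(congr1 (fun F : {poly {poly R}} => F`_k`_i)).
    by rewrite ReP_coef // !coef_map_id0 ?map_poly0 ?raddf0 // !coef0.
  move: Im0 => /(congr1 (fun F : {poly {poly R}} => F`_k`_i)).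
  by rewrite ImP_coef // !coef_map_id0 ?map_poly0 ?raddf0 // !coef0.
by move=> /eqP; rewrite mulf_eq0 expf_eq0 (negbTE (neq0Ci _)) andbF => /eqP.
Qed.

Lemma border_polynomial t a : a t != 0 ->
  (forall g : {poly {poly {poly R}}},
      rdivides g (ReP_jw t a) -> rdivides g (ImP_jw t a) -> ~ depends_on_w g) ->
  exists F : {poly {poly R}},
    [/\ F != 0, tdeg_le (2 * t * Pdeg_rp t a + 2 * Pdeg_rp t a) F &
        forall z, Dborder t a z -> bieval2 F z.1 z.2 = 0].
Proof.
move=> at0 no_div; set d := Pdeg_rp t a.
pose A := ReP_jw t a; pose B := ImP_jw t a.
have sA : (size A <= t.+1)%N by exact: size_poly.
have sB : (size B <= t.+1)%N by exact: size_poly.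
(* As j^t has modulus 1, this is |a_t|^2, a real polynomial with exactly the real zeros of a_t. *)
pose N := A`_t * A`_t + B`_t * B`_t.
have NE x y : (bieval2 N x y == 0) = (bieval2 A`_t x y == 0) && (bieval2 B`_t x y == 0).
  rewrite bieval2D !bieval2M -!expr2.
  by rewrite paddr_eq0 ?sqr_ge0 // !sqrf_eq0.
have N0 : N != 0.
  have /orP [] := lead_ReP_ImP_neq0 at0 => AB0.
    have [x [y [_ _ _ _ Axy]]] := nonzero_point 0 0 AB0 (@ltr01 R).
    apply: contra_neq Axy => N0; apply/eqP.
    by have := NE x y; rewrite N0 /bieval2 !horner0 eqxx => /esym /andP [].
  have [x [y [_ _ _ _ Bxy]]] := nonzero_point 0 0 AB0 (@ltr01 R).
  apply: contra_neq Bxy => N0; apply/eqP.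
  by have := NE x y; rewrite N0 /bieval2 !horner0 eqxx => /esym /andP [].
have res0 : resultant A B != 0.
  rewrite resultant_eq0; apply/negP => sg.
  have [|g [sg1 gA gB]] := gauss_common_divisor _ sg.
    by do 2!apply: factorial_poly; exact: factorial_field.
  exact: no_div gA gB sg1.
exists (resultant A B * N); split.
- by rewrite mulf_neq0.
- apply: tdeg_leM; last first.
    rewrite mul2n -addnn; apply: tdeg_leD; apply: tdeg_leM;
      [exact: tdeg_le_ReP|exact: tdeg_le_ReP|exact: tdeg_le_ImP|exact: tdeg_le_ImP].
  (* The first summand of q: at most [2 * t] rows, each contributing an entry of degree at most
     [d]. *)
  apply: (@tdeg_le_leq _ (((size B).-1 + (size A).-1) * d)).
    have pred_le (s : nat) : (s <= t.+1)%N -> (s.-1 <= t)%N by case: s.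
    by rewrite leq_mul2r mul2n -addnn leq_add ?orbT ?pred_le.
  apply: tdeg_le_det => i j; rewrite Sylvester_mxE.
  case: (fintype.split i) => k; rewrite mulrb; case: ifP => _;
    [exact: tdeg_le_ReP|exact: tdeg_le0|exact: tdeg_le_ImP|exact: tdeg_le0].
move=> z /DborderE zB; rewrite bieval2M.
have lead_case : bieval2 A`_t z.1 z.2 = 0 /\ bieval2 B`_t z.1 z.2 = 0 ->
    bieval2 (resultant A B) z.1 z.2 * bieval2 N z.1 z.2 = 0.
  by move=> [Az Bz]; apply/eqP; rewrite mulf_eq0 NE Az Bz eqxx orbT.
case: zB => [[w [Aw Bw]]|]; last exact: lead_case.
(* For [t = 0] the Sylvester matrix is empty and the resultant is 1, but then P is [a 0] alone and
   the root condition is the one on the leading coefficient. *)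
have [t0|t0] := posnP t.
  apply: lead_case; move: Aw Bw; rewrite !(@trieval_wide _ _ t.+1) //.
  by rewrite -/A -/B t0 !big_ord1 !expr0 !mulr1.
rewrite (_ : bieval2 _ _ _ = 0) ?mul0r //.
apply: (resultant_common_root (phi := bieval2_morphism z.1 z.2) _ Aw Bw).
have size_gt (T : {poly {poly {poly R}}}) : T`_t != 0 -> (0 < (size T).-1)%N.
  move=> Tt; rewrite -(subn1 (size T)) subn_gt0; apply: leq_trans (_ : t < size T)%N => //.
  by rewrite ltnNge; apply: contraNN Tt => ?; rewrite nth_default.
rewrite addn_gt0; have /orP [At|Bt] := lead_ReP_ImP_neq0 at0.
  by rewrite (size_gt _ At) orbT.
by rewrite (size_gt _ Bt).
Qed.

End Border.

(** The resultant also vanishes where the common root w is not real, so [x] may be a zero of [F] off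
    the border. The border is closed, though: a box around [x] avoids it, some point of the box is
    not a zero of [F], and a segment in the box joins the two. *)
Lemma Dregion_nonzero_point (R : realType) (t : nat) (a : nat -> {poly {poly R[i]}})
    (F : {poly {poly R}}) (x : R * R) : F != 0 -> ~ Dborder t a x ->
  exists z, nonzero_set F z /\ connected_component (~` Dborder t a) x z.
Proof.
case: x => x y F0 /DborderE /not_orP [noroot nolead].
have [||w||e e0 He] := @no_common_root_near R t (ReP_jw t a) (ImP_jw t a) x y.
- exact: size_poly.
- exact: size_poly.
- by move=> Pw; apply: noroot; exists w.
- exact: nolead.
have [x' [y' [xx' x'e yy' y'e Fz]]] := nonzero_point x y F0 e0.
exists (x', y'); split=> //.
pose f s : R * R := (x + (x' - x) * s, y + (y' - y) * s).
have f0 : f 0 = (x, y) by rewrite /f !mulr0 !addr0.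
have f1 : f 1 = (x', y') by rewrite /f !mulr1 ![_ + (_ - _)]addrC !subrK.
rewrite -f0 -f1; apply: (connected_component_path (a := 0) (b := 1)) => //.
  exact: affine_continuous.
have box (u v s : R) : u < v -> v < u + e -> 0 <= s -> s <= 1 ->
    u - e < u + (v - u) * s /\ u + (v - u) * s < u + e by nra.
move=> s s0 s1; have [x1 x2] := box x x' s xx' x'e s0 s1.
have [y1 y2] := box y y' s yy' y'e s0 s1.
by have [nr nl] := He _ _ x1 x2 y1 y2; move=> /DborderE [[w /nr]|/nl].
Qed.

Unset Implicit Arguments.

(* The number of regions of the D-decomposition is at most (q^2+q+2)/2:
   any family of points lying in pairwise distinct regions has at most
   that many members. *)
Theorem theorem2 (R : realType) (t : nat) (a : nat -> {poly {poly R[i]}}) :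
  a t != 0 ->
  (forall g : {poly {poly {poly R}}},
      rdivides g (ReP_jw t a) -> rdivides g (ImP_jw t a) -> ~ depends_on_w g) ->
  let d := Pdeg_rp t a in
  let q := (2 * t * d + 2 * d)%N in
  forall (n : nat) (x : 'I_n -> R * R),
    (forall k, ~ Dborder t a (x k)) ->
    (forall k l, k != l -> Dregion t a (x k) <> Dregion t a (x l)) ->
    (n <= (q ^ 2 + q + 2) %/ 2)%N.
Proof.
move=> at0 no_div d q n x xB x_inj.
have [F [F0 FD FB]] := border_polynomial at0 no_div.
have [z zP] := choice (fun k => Dregion_nonzero_point F0 (xB k)).
apply: (components_count (z := z) F0 FD) => [k|k l zkl]; first by have [] := zP k.
apply/eqP/negPn/negP => /x_inj; apply; rewrite /Dregion.
have [_ /same_connected_component ->] := zP k.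
have [_ /same_connected_component ->] := zP l.
apply: same_connected_component.
(* A component of [F != 0] is connected and avoids the border, so it lies in one region:
   representatives in the same component would belong to equal regions. *)
apply: (@connected_component_max _ _ (connected_component (nonzero_set F) (z k))) => //.
- by apply: connected_component_refl; have [] := zP k.
- by move=> u /connected_component_sub Fu /FB; move/eqP: Fu.
- exact: component_connected.
Qed.
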